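(* Let $N=|\mathbf x|\ge2$, $1\le i\le N-1$, and let $\mathfrak B_{i^-}$ be the $(A,A)$-bimodule of the negative braiding functor $\beta_{i^-}$ described in the context. Then $$H^n\operatorname{Hom}(\mathrm{id},\beta_{i^-})=\mathrm{HH}^n(\mathfrak B_{i^-})\cong\begin{cases}\Bbbk^{\mathbb Z_{\ge1}}, & n=0,\\ \Bbbk^{\mathbb Z_{\ge0}}, & n=1,\\ \Bbbk^{N-2}, & n=2,\\ 0,& n\ge3,\end{cases}$$ where $\Bbbk^{\mathbb Z_{\ge m}}=\bigoplus_{\ell\ge m}\Bbbk$.
   Context: Let $\Bbbk$ be a field. $\mathcal C$ is the $\Bbbk$-linear category (regarded as an $A_\infty$-category concentrated in degree $0$ with $\mu^d=0$ for $d\neq2$) with objects $T_0,\dots,T_N$, where $\operatorname{Hom}(T_i,T_j)$ has $\Bbbk$-basis $\{a_{ji}s^\alpha\}_{\alpha\ge0}$ and composition $$a_{kj}s^\beta\cdot a_{ji}s^\alpha=a_{ki}s^{\alpha+\beta+\delta(i,j,k)},\qquad \delta(i,j,k)=\tfrac12\big(|i-j|+|j-k|-|i-k|\big);$$ $e_i=a_{ii}s^0$ is the identity of $T_i$. $A=\bigoplus_{i,j}\operatorname{Hom}(T_i,T_j)$ is the associated unital algebra and $\Delta=A$ its diagonal bimodule. The negative braiding functor $\beta_{i^-}$ (the action on the Fukaya category of the clockwise exchange of the punctures $x_i,x_{i+1}$, i.e. of $\sigma_i^{-1}$) corresponds to the $(A,A)$-bimodule $\mathfrak B_{i^-}$ which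 fits in a short exact sequence of bimodules $$0\to\mathfrak B_{i^-}\xrightarrow{\iota_i}\Delta\xrightarrow{\pi_i}\mathfrak S_i\to0,$$ where $\mathfrak S_i$ is the one-dimensional bimodule spanned by one element $\epsilon_i$ with $e_i\cdot\epsilon_i\cdot e_i=\epsilon_i$ and $x\cdot\epsilon_i\cdot y=0$ for basis elements $x,y$ of the form $a_{kj}s^\alpha$ unless $x=y=e_i$; and $\pi_i(e_i)=\epsilon_i$ while $\pi_i$ sends every other basis element $a_{kj}s^\alpha$ to $0$. Thus $\mathfrak B_{i^-}$ is identified with the two-sided ideal of $A$ spanned by all basis elements other than $e_i$. For an $(A,A)$-bimodule $M$, $\mathrm{HH}^n(M)=\operatorname{Ext}^n_{A\text{-mod-}A}(A,M)$. $H^n\operatorname{Hom}(\mathrm{id},\beta_{i^-})$ is the degree-$n$ cohomology of the complex of $A_\infty$-pre-natural transformations from the identity functor to $\beta_{i^-}$ on $\mathrm{Tw}^b(\mathcal C)$, which by Morita equivalence is $\mathrm{HH}^n(\mathfrak B_{i^-})$. *)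

(* Defs.v *)
(* The classical axioms of boolp are what makes spaces of arbitrary functions,
   subspaces given by a Prop and quotients of these lmodTypes. *)
From HB Require Import structures.
From mathcomp Require Import all_boot all_order all_algebra.
From mathcomp Require Import boolp functions.
From mathcomp Require Import monalg.
From mathcomp Require Import zify.

Set Implicit Arguments.
Unset Strict Implicit.
Unset Printing Implicit Defensive.

Import GRing.Theory.
Local Open Scope ring_scope.
Local Open Scope quotient_scope.

Definition lin_isomorphic (k : fieldType) (U V : lmodType k) : Prop :=
  exists f : {linear U -> V}, bijective f.

Record subspace (k : fieldType) (V : lmodType k) := Subspace {
  in_subspace :> V -> Prop;
  subspace0 : in_subspace 0;
  subspaceP : forall (c : k) u v,
    in_subspace u -> in_subspace v -> in_subspace (c *: u + v) }.

Section Subspace.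
Variables (k : fieldType) (V : lmodType k) (S : subspace V).

Definition submem : {pred V} := fun x => `[< S x >].

Fact submem_submod_closed : submod_closed submem.
Proof.
split=> [|c u v /asboolP Su /asboolP Sv]; apply/asboolP.
  exact: subspace0.
exact: subspaceP.
Qed.
HB.instance Definition _ :=
  GRing.isSubmodClosed.Build k V submem submem_submod_closed.

Record submod := Submod { submod_val : V; _ : submod_val \in submem }.
HB.instance Definition _ := [isSub for submod_val].
HB.instance Definition _ := [Choice of submod by <:].
HB.instance Definition _ := [SubChoice_isSubLmodule of submod by <:].

Lemma submodP (x : submod) : S (val x).
Proof. by have /asboolP := valP x. Qed.

Lemma submod_valP (c : k) (x y : submod) :
  submod_val (c *: x + y) = c *: submod_val x + submod_val y.
Proof. exact: (linearP (val : submod -> V)). Qed.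

Definition to_submod (x : V) (Sx : S x) : submod := Submod (asboolT Sx).

Definition quotmod := {ideal_quot submem}.
HB.instance Definition _ := GRing.Zmodule.on quotmod.

Definition quotmod_scale (c : k) (q : quotmod) : quotmod :=
  \pi_{ideal_quot submem} (c *: repr q).

Definition quotmod_pi (x : V) : quotmod := \pi_{ideal_quot submem} x.

Lemma quotmod_piP x y : quotmod_pi x = quotmod_pi y <-> S (x - y).
Proof.
have E : (x - y \in submem) = (quotmod_pi x == quotmod_pi y).
  exact: Quotient.idealrBE.
by split=> [/eqP | h]; [rewrite -E => /asboolP | apply/eqP; rewrite -E; apply/asboolP].
Qed.

Lemma quotmod_piK q : quotmod_pi (repr q) = q.
Proof. exact: reprK. Qed.

Lemma quotmod_piD x y : quotmod_pi (x + y) = quotmod_pi x + quotmod_pi y.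
Proof. exact: (raddfD \pi_{ideal_quot submem}). Qed.

Lemma quotmod_scaleE c x :
  quotmod_scale c (quotmod_pi x) = quotmod_pi (c *: x).
Proof.
apply/quotmod_piP; rewrite -scalerBr -[_ *: _]addr0.
apply: subspaceP (subspace0 S).
by apply/quotmod_piP; rewrite quotmod_piK.
Qed.

Fact quotmod_scaleA a b v :
  quotmod_scale a (quotmod_scale b v) = quotmod_scale (a * b) v.
Proof. by rewrite -[v]quotmod_piK !quotmod_scaleE scalerA. Qed.
Fact quotmod_scale1 : left_id 1 quotmod_scale.
Proof. by move=> v; rewrite -[v]quotmod_piK quotmod_scaleE scale1r. Qed.
Fact quotmod_scaleDr : right_distributive quotmod_scale +%R.
Proof.
move=> a u v; rewrite -[u]quotmod_piK -[v]quotmod_piK -quotmod_piD.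
by rewrite !quotmod_scaleE scalerDr quotmod_piD.
Qed.
Fact quotmod_scaleDl v : {morph quotmod_scale^~ v : a b / a + b}.
Proof.
move=> a b /=; rewrite -[v]quotmod_piK !quotmod_scaleE scalerDl.
by rewrite quotmod_piD.
Qed.
HB.instance Definition _ := GRing.Zmodule_isLmodule.Build k quotmod
  quotmod_scaleA quotmod_scale1 quotmod_scaleDr quotmod_scaleDl.

Fact quotmod_pi_linear : linear quotmod_pi.
Proof. by move=> c u v; rewrite quotmod_piD -quotmod_scaleE. Qed.
HB.instance Definition _ :=
  GRing.isLinear.Build k V quotmod _ quotmod_pi quotmod_pi_linear.

End Subspace.

Record cochain_complex (k : fieldType) := CochainComplex {
  cc_obj : nat -> lmodType k;
  cc_diff : forall n, {linear cc_obj n -> cc_obj n.+1};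
  cc_diff2 : forall n x, cc_diff n.+1 (cc_diff n x) = 0 }.

Section Cohomology.
Variables (k : fieldType) (C : cochain_complex k).

Fact cocycle0 n : cc_diff C n 0 = 0.
Proof. exact: raddf0. Qed.
Fact cocycleP n (c : k) u v : cc_diff C n u = 0 -> cc_diff C n v = 0 ->
  cc_diff C n (c *: u + v) = 0.
Proof. by move=> hu hv; rewrite linearP hu hv scaler0 addr0. Qed.
Definition cocycles n : subspace (cc_obj C n) :=
  @Subspace k _ (fun x => cc_diff C n x = 0) (cocycle0 n) (@cocycleP n).

Definition is_coboundary n : cc_obj C n -> Prop :=
  match n return cc_obj C n -> Prop with
  | 0 => fun x => x = 0
  | m.+1 => fun x => exists y, cc_diff C m y = x
  end.

Fact coboundary0 n : @is_coboundary n (val (0 : submod (cocycles n))).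
Proof. by case: n => [|n] //=; exists 0; rewrite raddf0. Qed.
Fact coboundaryP n (c : k) (u v : submod (cocycles n)) :
  is_coboundary (val u) -> is_coboundary (val v) ->
  is_coboundary (val (c *: u + v)).
Proof.
have -> : val (c *: u + v) = c *: val u + val v by exact: submod_valP.
move: (val u) (val v) => {u v}; case: n => [|n] u v /=.
  by move=> -> ->; rewrite scaler0 addr0.
by move=> [x <-] [y <-]; exists (c *: x + y); rewrite linearP.
Qed.
Definition coboundaries n : subspace (submod (cocycles n)) :=
  @Subspace k _ (fun x => is_coboundary (val x))
    (coboundary0 n) (@coboundaryP n).

Definition cohomology n : lmodType k := quotmod (coboundaries n).

End Cohomology.

Record bimodule (k : fieldType) (A : algType k) := Bimodule {
  bim_sort :> lmodType k;
  lact : A -> bim_sort -> bim_sort;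
  ract : bim_sort -> A -> bim_sort;
  lactPl : forall (c : k) x y m, lact (c *: x + y) m = c *: lact x m + lact y m;
  lactPr : forall x (c : k) m n, lact x (c *: m + n) = c *: lact x m + lact x n;
  ractPl : forall (c : k) m n x, ract (c *: m + n) x = c *: ract m x + ract n x;
  ractPr : forall m (c : k) x y, ract m (c *: x + y) = c *: ract m x + ract m y;
  lact1 : forall m, lact 1 m = m;
  ract1 : forall m, ract m 1 = m;
  lactM : forall x y m, lact (x * y) m = lact x (lact y m);
  ractM : forall m x y, ract m (x * y) = ract (ract m x) y;
  lract : forall x m y, lact x (ract m y) = ract (lact x m) y }.

Section Bimodules.
Variables (k : fieldType) (A : algType k).
Implicit Types M N P : bimodule A.

Definition is_bimod_hom M N (f : M -> N) : Prop :=
  [/\ forall (c : k) m n, f (c *: m + n) = c *: f m + f n,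
      forall x m, f (lact x m) = lact x (f m) &
      forall m x, f (ract m x) = ract (f m) x].

Section ActionLemmas.
Variable M : bimodule A.
Implicit Types (x y : A) (m n : M).

Lemma lactDl x y m : lact (x + y) m = lact x m + lact y m.
Proof. by have := lactPl 1 x y m; rewrite !scale1r. Qed.
Lemma lact0l m : lact 0 m = 0.
Proof. by apply: (addrI (lact 0 m)); rewrite addr0 -lactDl addr0. Qed.
Lemma lactZl c x m : lact (c *: x) m = c *: lact x m.
Proof. by have := lactPl c x 0 m; rewrite lact0l !addr0. Qed.
Lemma lactDr x m n : lact x (m + n) = lact x m + lact x n.
Proof. by have := lactPr x 1 m n; rewrite !scale1r. Qed.
Lemma lact0r x : lact x 0 = 0 :> M.
Proof. by apply: (addrI (lact x 0)); rewrite addr0 -lactDr addr0. Qed.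
Lemma lactZr c x m : lact x (c *: m) = c *: lact x m.
Proof. by have := lactPr x c m 0; rewrite lact0r !addr0. Qed.
Lemma lactNr x m : lact x (- m) = - lact x m.
Proof. by rewrite -scaleN1r lactZr scaleN1r. Qed.
Lemma ractDr m x y : ract m (x + y) = ract m x + ract m y.
Proof. by have := ractPr m 1 x y; rewrite !scale1r. Qed.
Lemma ract0r m : ract m 0 = 0.
Proof. by apply: (addrI (ract m 0)); rewrite addr0 -ractDr addr0. Qed.
Lemma ractZr c x m : ract m (c *: x) = c *: ract m x.
Proof. by have := ractPr m c x 0; rewrite ract0r !addr0. Qed.
Lemma ractDl x m n : ract (m + n) x = ract m x + ract n x.
Proof. by have := ractPl 1 m n x; rewrite !scale1r. Qed.
Lemma ract0l x : ract 0 x = 0 :> M.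
Proof. by apply: (addrI (ract 0 x)); rewrite addr0 -ractDl addr0. Qed.
Lemma ractZl c x m : ract (c *: m) x = c *: ract m x.
Proof. by have := ractPl c m 0 x; rewrite ract0l !addr0. Qed.
Lemma ractNl x m : ract (- m) x = - ract m x.
Proof. by rewrite -scaleN1r ractZl scaleN1r. Qed.
End ActionLemmas.

Definition diagonal : bimodule A.
Proof.
apply: (@Bimodule k A A (fun x m => x * m) (fun m x => m * x)).
- by move=> c x y m; rewrite mulrDl scalerAl.
- by move=> x c m n; rewrite mulrDr scalerAr.
- by move=> c m n x; rewrite mulrDl scalerAl.
- by move=> m c x y; rewrite mulrDr scalerAr.
- exact: mul1r.
- exact: mulr1.
- by move=> x y m; rewrite mulrA.
- by move=> m x y; rewrite mulrA.
- by move=> x m y; rewrite mulrA.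
Defined.

Fact bimod_hom0 M N : is_bimod_hom (0 : M -> N).
Proof.
by split=> *; rewrite ?lact0r ?ract0l // scaler0 addr0.
Qed.
Fact bimod_homP M N (c : k) (f g : M -> N) :
  is_bimod_hom f -> is_bimod_hom g -> is_bimod_hom (c *: f + g).
Proof.
have E x : (c *: f + g) x = c *: f x + g x by [].
move=> [f1 f2 f3] [g1 g2 g3]; split=> *; rewrite !E.
- rewrite f1 g1 !scalerDr !scalerA (mulrC c) -!addrA; congr (_ + _).
  by rewrite addrCA.
- by rewrite f2 g2 lactPr.
- by rewrite f3 g3 ractPl.
Qed.
Definition bimod_homs M N : subspace (M -> N) :=
  @Subspace k _ (@is_bimod_hom M N) (@bimod_hom0 M N) (@bimod_homP M N).
Definition bimod_hom M N := submod (bimod_homs M N).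
HB.instance Definition _ M N := GRing.Lmodule.on (bimod_hom M N).

Definition bimod_hom_fun M N (f : bimod_hom M N) : M -> N := val f.
Coercion bimod_hom_fun : bimod_hom >-> Funclass.

Lemma bimod_hom_is M N (f : bimod_hom M N) : is_bimod_hom f.
Proof. exact: (@submodP _ _ (bimod_homs M N) f). Qed.

Section HomLemmas.
Variables (M N : bimodule A) (f : bimod_hom M N).
Lemma bhomP (c : k) m n : f (c *: m + n) = c *: f m + f n.
Proof. by case: (bimod_hom_is f). Qed.
Lemma bhomD m n : f (m + n) = f m + f n.
Proof. by have := bhomP 1 m n; rewrite !scale1r. Qed.
Lemma bhom0 : f 0 = 0.
Proof. by apply: (addrI (f 0)); rewrite addr0 -bhomD addr0. Qed.
Lemma bhom_lact x m : f (lact x m) = lact x (f m).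
Proof. by case: (bimod_hom_is f). Qed.
Lemma bhom_ract m x : f (ract m x) = ract (f m) x.
Proof. by case: (bimod_hom_is f). Qed.
End HomLemmas.

Fact bimod_comp_subproof M N P (g : bimod_hom N P) (f : bimod_hom M N) :
  is_bimod_hom (g \o f).
Proof.
by split=> * /=; rewrite ?bhomP ?bhom_lact ?bhom_ract.
Qed.
Definition bimod_comp M N P (g : bimod_hom N P) (f : bimod_hom M N) :
  bimod_hom M P := to_submod (S := bimod_homs M P) (bimod_comp_subproof g f).

Section Kernel.
Variables (M N : bimodule A) (f : bimod_hom M N).

Definition bimod_ker_space : subspace M :=
  @Subspace k M (fun m => f m = 0) (bhom0 f)
   (fun c u v hu hv => etrans (bhomP f c u v)
      (etrans (congr2 +%R (etrans (congr1 (GRing.scale c) hu) (scaler0 _ c)) hv)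
         (addr0 0))).

Fact bimod_ker_lact x (m : submod bimod_ker_space) : f (lact x (val m)) = 0.
Proof. by rewrite bhom_lact (submodP m) lact0r. Qed.
Fact bimod_ker_ract (m : submod bimod_ker_space) x : f (ract (val m) x) = 0.
Proof. by rewrite bhom_ract (submodP m) ract0l. Qed.

Definition bimod_ker : bimodule A.
Proof.
apply: (@Bimodule k A (submod bimod_ker_space)
  (fun x m => to_submod (S := bimod_ker_space) (bimod_ker_lact x m))
  (fun m x => to_submod (S := bimod_ker_space) (bimod_ker_ract m x))).
- by move=> c x y m; apply: val_inj; rewrite [RHS]submod_valP /= lactPl.
- by move=> x c m n; apply: val_inj; rewrite [RHS]submod_valP /= lactPr.
- by move=> c m n x; apply: val_inj; rewrite [RHS]submod_valP /= ractPl.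
- by move=> m c x y; apply: val_inj; rewrite [RHS]submod_valP /= ractPr.
- by move=> m; apply: val_inj; rewrite /= lact1.
- by move=> m; apply: val_inj; rewrite /= ract1.
- by move=> x y m; apply: val_inj; rewrite /= lactM.
- by move=> m x y; apply: val_inj; rewrite /= ractM.
- by move=> x m y; apply: val_inj; rewrite /= lract.
Defined.

Fact bimod_ker_incl_subproof :
  is_bimod_hom (fun m : bimod_ker => submod_val m : M).
Proof. by split=> // c m n; apply: submod_valP. Qed.
Definition bimod_ker_incl : bimod_hom bimod_ker M :=
  to_submod (S := bimod_homs bimod_ker M) bimod_ker_incl_subproof.
End Kernel.

Definition surjective_hom M N (f : bimod_hom M N) : Prop :=
  forall y, exists x, f x = y.

Definition projective P : Prop :=
  forall M N (g : bimod_hom M N) (h : bimod_hom P N), surjective_hom g ->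
  exists h' : bimod_hom P M, forall p, g (h' p) = h p.

Record projective_resolution M := ProjectiveResolution {
  res_obj : nat -> bimodule A;
  res_diff : forall n, bimod_hom (res_obj n.+1) (res_obj n);
  res_aug : bimod_hom (res_obj 0) M;
  res_projective : forall n, projective (res_obj n);
  res_aug_surj : surjective_hom res_aug;
  res_aug_exact : forall x, res_aug x = 0 <-> exists y, res_diff 0 y = x;
  res_exact : forall n x,
    res_diff n x = 0 <-> exists y, res_diff n.+1 y = x }.

Section Ext.
Variables (M : bimodule A) (P : projective_resolution M) (N : bimodule A).

Definition ext_diff n (f : bimod_hom (res_obj P n) N) :
  bimod_hom (res_obj P n.+1) N := bimod_comp f (res_diff P n).

Fact ext_diff_linear n : linear (@ext_diff n).
Proof.
by move=> c f g; apply: val_inj; rewrite linearP.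
Qed.
HB.instance Definition _ n := GRing.isLinear.Build k _ _ _ (@ext_diff n)
  (@ext_diff_linear n).

Fact ext_diff2 n f : ext_diff (@ext_diff n f) = 0.
Proof.
apply: val_inj; apply/funext => x.
change (f (res_diff P n (res_diff P n.+1 x)) = 0).
suff -> : res_diff P n (res_diff P n.+1 x) = 0 by exact: (bhom0 f).
by apply/res_exact; exists x.
Qed.

Definition ext_complex : cochain_complex k :=
  @CochainComplex k (fun n => bimod_hom (res_obj P n) N : lmodType k)
    (fun n => @ext_diff n) ext_diff2.

(* Ext^n(M, N), which does not depend on P up to isomorphism; free_resolution
   below is a projective resolution of an arbitrary bimodule. *)
Definition Ext n : lmodType k := cohomology ext_complex n.
End Ext.

Definition HH (P : projective_resolution diagonal) (N : bimodule A) n :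
  lmodType k := Ext P N n.

End Bimodules.

Section FreeBimodule.
Variables (k : fieldType) (A : algType k) (X : choiceType).
Implicit Types (s : seq (A * X * A)) (M N : bimodule A).

(* The free bimodule on X consists of the formal sums of expressions a x b,
   identified when they have the same value in every bimodule.                *)

Definition fb_ev M (f : X -> M) s : M :=
  \sum_(t <- s) lact t.1.1 (ract (f t.1.2) t.2).

Definition fb_eqv s1 s2 : bool :=
  `[< forall (M : bimodule A) (f : X -> M), fb_ev f s1 = fb_ev f s2 >].

Fact fb_eqv_equiv : equiv_class_of fb_eqv.
Proof.
split=> [s|s t|t s u].
- by apply/asboolP.
- by apply/asboolP/asboolP => h M f; rewrite h.
- by move=> /asboolP h1 /asboolP h2; apply/asboolP => M f; rewrite h1 h2.
Qed.
Canonical fb_eqv_rel := EquivRelPack fb_eqv_equiv.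
Canonical fb_eqv_enc := defaultEncModRel fb_eqv.

Definition fb_quot := {eq_quot fb_eqv}.
HB.instance Definition _ := Choice.on fb_quot.

Definition fb_pi s : fb_quot := \pi_{eq_quot fb_eqv} s.
Definition fb_lift M (f : X -> M) (q : fb_quot) : M := fb_ev f (repr q).

Lemma fb_lift_pi M (f : X -> M) s : fb_lift f (fb_pi s) = fb_ev f s.
Proof.
have : fb_eqv (repr (fb_pi s)) s by apply/eqmodP; rewrite reprK.
by move/asboolP; exact.
Qed.

Lemma fb_quotP (q r : fb_quot) :
  (forall M (f : X -> M), fb_lift f q = fb_lift f r) -> q = r.
Proof.
move=> h; rewrite -[q]reprK -[r]reprK; apply/eqmodP; apply/asboolP => M f.
exact: h.
Qed.

Definition fb_add (q r : fb_quot) : fb_quot := fb_pi (repr q ++ repr r).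
Definition fb_map (g : A * X * A -> A * X * A) (q : fb_quot) : fb_quot :=
  fb_pi (map g (repr q)).
Definition fb_lact x := fb_map (fun t => (x * t.1.1, t.1.2, t.2)).
Definition fb_ract (q : fb_quot) x := fb_map (fun t => (t.1.1, t.1.2, t.2 * x)) q.
Definition fb_scale (c : k) := fb_map (fun t => (c *: t.1.1, t.1.2, t.2)).

Section LiftE.
Variables (M : bimodule A) (f : X -> M).
Lemma fb_lift0 : fb_lift f (fb_pi [::]) = 0.
Proof. by rewrite fb_lift_pi /fb_ev big_nil. Qed.
Lemma fb_liftD q r : fb_lift f (fb_add q r) = fb_lift f q + fb_lift f r.
Proof. by rewrite fb_lift_pi /fb_ev big_cat. Qed.
Lemma fb_liftZ c q : fb_lift f (fb_scale c q) = c *: fb_lift f q.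
Proof.
rewrite fb_lift_pi /fb_lift /fb_ev big_map scaler_sumr.
by apply: eq_bigr => t _ /=; rewrite lactZl.
Qed.
Lemma fb_lift_lact x q : fb_lift f (fb_lact x q) = lact x (fb_lift f q).
Proof.
rewrite fb_lift_pi /fb_lift /fb_ev big_map.
elim: (repr q) => [|t s IH]; rewrite ?big_nil ?lact0r // !big_cons lactDr IH.
by rewrite lactM.
Qed.
Lemma fb_lift_ract x q : fb_lift f (fb_ract q x) = ract (fb_lift f q) x.
Proof.
rewrite fb_lift_pi /fb_lift /fb_ev big_map.
elim: (repr q) => [|t s IH]; rewrite ?big_nil ?ract0l // !big_cons ractDl IH.
by rewrite /= ractM lract.
Qed.
End LiftE.
Definition fb_liftE := (fb_lift0, fb_liftD, fb_liftZ, fb_lift_lact, fb_lift_ract).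

Fact fb_addA : associative fb_add.
Proof. by move=> p q r; apply: fb_quotP => M f; rewrite !fb_liftE addrA. Qed.
Fact fb_addC : commutative fb_add.
Proof. by move=> p q; apply: fb_quotP => M f; rewrite !fb_liftE addrC. Qed.
Fact fb_add0 : left_id (fb_pi [::]) fb_add.
Proof. by move=> p; apply: fb_quotP => M f; rewrite !fb_liftE add0r. Qed.
Fact fb_addN : left_inverse (fb_pi [::]) (fb_scale (-1)) fb_add.
Proof.
by move=> p; apply: fb_quotP => M f; rewrite !fb_liftE scaleN1r addNr.
Qed.
HB.instance Definition _ :=
  GRing.isZmodule.Build fb_quot fb_addA fb_addC fb_add0 fb_addN.

Fact fb_scaleA a b v : fb_scale a (fb_scale b v) = fb_scale (a * b) v.
Proof. by apply: fb_quotP => M f; rewrite !fb_liftE scalerA. Qed.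
Fact fb_scale1 : left_id 1 fb_scale.
Proof. by move=> v; apply: fb_quotP => M f; rewrite !fb_liftE scale1r. Qed.
Fact fb_scaleDr : right_distributive fb_scale +%R.
Proof. by move=> a u v; apply: fb_quotP => M f; rewrite !fb_liftE scalerDr. Qed.
Fact fb_scaleDl v : {morph fb_scale^~ v : a b / a + b}.
Proof. by move=> a b; apply: fb_quotP => M f; rewrite !fb_liftE scalerDl. Qed.
HB.instance Definition _ := GRing.Zmodule_isLmodule.Build k fb_quot
  fb_scaleA fb_scale1 fb_scaleDr fb_scaleDl.

Lemma fb_liftP M (f : X -> M) (c : k) (q r : fb_quot) :
  fb_lift f (c *: q + r) = c *: fb_lift f q + fb_lift f r.
Proof. by rewrite fb_liftD fb_liftZ. Qed.

Definition free_bimodule : bimodule A.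
Proof.
apply: (@Bimodule k A fb_quot fb_lact fb_ract).
- move=> c x y m; apply: fb_quotP => M f.
  by rewrite fb_liftP !fb_liftE lactPl.
- move=> x c m n; apply: fb_quotP => M f.
  by rewrite fb_liftP !fb_lift_lact fb_liftP lactPr.
- move=> c m n x; apply: fb_quotP => M f.
  by rewrite fb_liftP !fb_lift_ract fb_liftP ractPl.
- move=> m c x y; apply: fb_quotP => M f.
  by rewrite fb_liftP !fb_lift_ract ractPr.
- by move=> m; apply: fb_quotP => M f; rewrite fb_liftE lact1.
- by move=> m; apply: fb_quotP => M f; rewrite fb_liftE ract1.
- by move=> x y m; apply: fb_quotP => M f; rewrite !fb_liftE lactM.
- by move=> m x y; apply: fb_quotP => M f; rewrite !fb_liftE ractM.
- by move=> x m y; apply: fb_quotP => M f; rewrite !fb_liftE lract.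
Defined.

Fact fb_hom_subproof M (f : X -> M) : is_bimod_hom (fb_lift f : free_bimodule -> M).
Proof.
split=> *; [exact: fb_liftP | exact: fb_lift_lact | exact: fb_lift_ract].
Qed.
Definition fb_hom M (f : X -> M) : bimod_hom free_bimodule M :=
  to_submod (S := bimod_homs free_bimodule M) (fb_hom_subproof f).

Definition fb_gen x : free_bimodule := fb_pi [:: (1, x, 1)].

Lemma fb_hom_gen M (f : X -> M) x : fb_hom f (fb_gen x) = f x.
Proof.
by change (fb_lift f (fb_pi [:: (1, x, 1)]) = f x);
   rewrite fb_lift_pi /fb_ev big_seq1 /= lact1 ract1.
Qed.

Lemma fb_hom_ext M (g h : bimod_hom free_bimodule M) :
  (forall x, g (fb_gen x) = h (fb_gen x)) -> forall q, g q = h q.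
Proof.
move=> gh q; rewrite -[q](reprK (q : {eq_quot fb_eqv})) -/(fb_pi _).
elim: (repr q) => [|[[a x] b] s IH].
  by have -> : fb_pi [::] = 0 :> free_bimodule by []; rewrite !bhom0.
have -> : fb_pi ((a, x, b) :: s) =
    lact a (ract (fb_gen x) b) + (fb_pi s : free_bimodule) :> free_bimodule.
  apply: fb_quotP => M' f.
  change (fb_lift f (fb_pi ((a, x, b) :: s)) =
    fb_lift f (fb_add (fb_lact a (fb_ract (fb_gen x) b)) (fb_pi s))).
  rewrite !fb_liftE !fb_lift_pi /fb_ev big_cons big_seq1 /=.
  by rewrite lact1 ract1.
by rewrite !bhomD !bhom_lact !bhom_ract gh IH.
Qed.

Lemma free_projective : projective free_bimodule.
Proof.
move=> M N g h g_surj.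
have [f fP] := choice (fun x => g_surj (h (fb_gen x))).
exists (fb_hom f); apply: (fb_hom_ext (g := bimod_comp g (fb_hom f))) => x.
by change (g (fb_hom f (fb_gen x)) = h (fb_gen x)); rewrite fb_hom_gen.
Qed.

End FreeBimodule.

Section FreeResolution.
Variables (k : fieldType) (A : algType k) (M : bimodule A).

Definition free_cover (N : bimodule A) : bimodule A := free_bimodule A N.
Definition free_cover_hom (N : bimodule A) : bimod_hom (free_cover N) N :=
  fb_hom (fun x : N => x).

Lemma free_cover_surj N : surjective_hom (free_cover_hom N).
Proof. by move=> y; exists (fb_gen A y); rewrite /free_cover_hom fb_hom_gen. Qed.

Fixpoint syzygy n : bimodule A :=
  if n is m.+1 then bimod_ker (free_cover_hom (syzygy m)) else M.

Definition free_res_diff n :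
    bimod_hom (free_cover (syzygy n.+1)) (free_cover (syzygy n)) :=
  bimod_comp (bimod_ker_incl (free_cover_hom (syzygy n)))
             (free_cover_hom (syzygy n.+1)).

Lemma free_res_im n x : free_cover_hom (syzygy n) x = 0 <->
  exists y, free_res_diff n y = x.
Proof.
split=> [hx | [y <-]]; last first.
  exact: (submodP (free_cover_hom (syzygy n.+1) y)).
have [y hy] := free_cover_surj
  (to_submod (S := bimod_ker_space (free_cover_hom (syzygy n))) hx
     : syzygy n.+1).
exists y.
by change (submod_val (free_cover_hom (syzygy n.+1) y) = x); rewrite hy.
Qed.

Fact free_res_exact n x :
  free_res_diff n x = 0 <-> exists y, free_res_diff n.+1 y = x.
Proof.
apply: iff_trans (free_res_im x); split=> h; first exact: val_inj.
by change (submod_val (free_cover_hom (syzygy n.+1) x) = 0); rewrite h.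
Qed.

Definition free_resolution : projective_resolution M :=
  @ProjectiveResolution k A M (fun n => free_cover (syzygy n)) free_res_diff
    (free_cover_hom M) (fun n => @free_projective _ _ _)
    (@free_cover_surj M) (@free_res_im 0) free_res_exact.

End FreeResolution.

Definition delta (i j l : nat) : nat :=
  ((`|i - j| + `|j - l|) - `|i - l|)%N./2.

Lemma delta_cocycle i j l m :
  (delta i j l + delta i l m = delta j l m + delta i j m)%N.
Proof. rewrite /delta; lia. Qed.

Lemma delta_iij i j : delta i i j = 0%N.
Proof. rewrite /delta; lia. Qed.

Lemma delta_ijj i j : delta i j j = 0%N.
Proof. rewrite /delta; lia. Qed.

Lemma delta_iji i j : delta i j i = `|i - j|%N.
Proof. rewrite /delta; lia. Qed.

Section Category.
Variables (k : fieldType) (N : nat).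

(* Hom(T_i, T_j) is represented by {poly k}, with 'X^a standing for a_{ji}s^a *)
Definition obj := 'I_N.+1.
Definition comp (i j l : obj) (y x : {poly k}) : {poly k} :=
  'X^(delta i j l) * (y * x).

Lemma compA (i j l m : obj) z y x :
  comp i l m z (comp i j l y x) = comp i j m (comp j l m z y) x.
Proof.
rewrite /comp; have E : 'X^(delta i l m) * 'X^(delta i j l) =
    'X^(delta i j m) * 'X^(delta j l m) :> {poly k}.
  by rewrite -!exprD addnC delta_cocycle addnC.
rewrite (mulrCA z) [LHS]mulrA E -!mulrA; congr (_ * (_ * _)).
Qed.

(* The component of index (i, j) is the one in Hom(T_i, T_j). *)
Definition Calg := {ffun obj * obj -> {poly k}}.
HB.instance Definition _ := GRing.Lmodule.on Calg.

Definition Calg_mul (y x : Calg) : Calg :=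
  [ffun p => \sum_(j : obj) comp p.1 j p.2 (y (j, p.2)) (x (p.1, j))].
Definition emb (i j : obj) (a : {poly k}) : Calg :=
  [ffun p => if p == (i, j) then a else 0].
Definition Calg_one : Calg := \sum_(j : obj) emb j j 1.

Lemma Calg_oneE i j : Calg_one (i, j) = (i == j)%:R.
Proof.
rewrite sum_ffunE (bigD1 i) //= ffunE big1 => [|l li]; last first.
  by rewrite ffunE xpair_eqE eq_sym (negbTE li).
by rewrite xpair_eqE eqxx /= addr0 eq_sym; case: (i == j).
Qed.

Fact Calg_mulA : associative Calg_mul.
Proof.
move=> z y x; apply/ffunP => -[i m]; rewrite !ffunE /=.
transitivity (\sum_j \sum_l comp i j m (comp j l m (z (l, m)) (y (j, l)))
                                     (x (i, j))).
  rewrite exchange_big; apply: eq_bigr => l _; rewrite ffunE /=.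
  rewrite /comp !mulr_sumr; apply: eq_bigr => j _; exact: compA.
apply: eq_bigr => j _; rewrite ffunE /=.
by rewrite /comp mulr_suml mulr_sumr.
Qed.
Fact Calg_mul1l : left_id Calg_one Calg_mul.
Proof.
move=> x; apply/ffunP => -[i j]; rewrite ffunE (bigD1 j) //= big1 => [|l lj].
  by rewrite Calg_oneE eqxx /comp delta_ijj expr0 !mul1r addr0.
by rewrite Calg_oneE (negbTE lj) /comp mul0r mulr0.
Qed.
Fact Calg_mul1r : right_id Calg_one Calg_mul.
Proof.
move=> x; apply/ffunP => -[i j]; rewrite ffunE (bigD1 i) //= big1 => [|l li].
  by rewrite Calg_oneE eqxx /comp delta_iij mulr1 expr0 mul1r addr0.
by rewrite Calg_oneE eq_sym (negbTE li) /comp !mulr0.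
Qed.
Fact Calg_mulDl : left_distributive Calg_mul +%R.
Proof.
move=> x y z; apply/ffunP => -[i j]; rewrite !ffunE /= -big_split.
by apply: eq_bigr => l _; rewrite ffunE /comp mulrDl mulrDr.
Qed.
Fact Calg_mulDr : right_distributive Calg_mul +%R.
Proof.
move=> x y z; apply/ffunP => -[i j]; rewrite !ffunE /= -big_split.
by apply: eq_bigr => l _; rewrite ffunE /comp !mulrDr.
Qed.
Fact Calg_one_neq0 : Calg_one != 0.
Proof.
apply/eqP => /ffunP /(_ (ord0, ord0)); rewrite Calg_oneE eqxx ffunE.
by apply/eqP; rewrite oner_neq0.
Qed.
HB.instance Definition _ := GRing.Zmodule_isNzRing.Build Calg
  Calg_mulA Calg_mul1l Calg_mul1r Calg_mulDl Calg_mulDr Calg_one_neq0.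

Fact Calg_scaleAl (c : k) (x y : Calg) : c *: (x * y) = (c *: x) * y.
Proof.
apply/ffunP => -[i j]; rewrite !ffunE /= scaler_sumr; apply: eq_bigr => l _.
by rewrite ffunE /comp -scalerAl -scalerAr.
Qed.
HB.instance Definition _ :=
  GRing.Lmodule_isLalgebra.Build k Calg Calg_scaleAl.
Fact Calg_scaleAr (c : k) (x y : Calg) : c *: (x * y) = x * (c *: y).
Proof.
apply/ffunP => -[i j]; rewrite !ffunE /= scaler_sumr; apply: eq_bigr => l _.
by rewrite ffunE /comp -!scalerAr.
Qed.
HB.instance Definition _ := GRing.Lalgebra_isAlgebra.Build k Calg Calg_scaleAr.

(* a_{ji}s^a and the idempotent e_i, as elements of A *)
Definition abas (j i : obj) (a : nat) : Calg := emb i j 'X^a.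
Definition idem (i : obj) : Calg := emb i i 1.

Lemma emb_linear i j c a b : emb i j (c *: a + b) = c *: emb i j a + emb i j b.
Proof.
apply/ffunP => p; rewrite !ffunE; case: ifP => // _.
by rewrite scaler0 addr0.
Qed.

Lemma emb_mul i j l y x : emb j l y * emb i j x = emb i l (comp i j l y x).
Proof.
apply/ffunP => -[i' l']; rewrite !ffunE (bigD1 j) //= big1 => [|j' jj'].
  rewrite !ffunE !xpair_eqE eqxx andbT addr0 /=.
  have [-> | _] := eqVneq i' i; have [-> | _] := eqVneq l' l;
    by rewrite /comp // ?mul0r ?mulr0.
by rewrite !ffunE xpair_eqE (negbTE jj') /= /comp mul0r mulr0.
Qed.

Lemma emb_mul0 i j j' l y x : j != j' -> emb j' l y * emb i j x = 0.
Proof.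
move=> jj'; apply/ffunP => -[i' l']; rewrite !ffunE big1 // => h _.
rewrite !ffunE !xpair_eqE /comp; have [-> | _] := eqVneq h j'; last first.
  by rewrite mul0r mulr0.
by rewrite [j' == j]eq_sym (negbTE jj') andbF !mulr0.
Qed.

Lemma abas_mul l j i b a :
  abas l j b * abas j i a = abas l i (a + b + delta i j l).
Proof. by rewrite /abas emb_mul /comp -!exprD addnC [(b + a)%N]addnC. Qed.

Lemma idemE i : idem i = abas i i 0.
Proof. by []. Qed.

(* The coefficient of e_i = a_{ii}s^0 *)
Definition ecoef (i : obj) (x : Calg) : k := (x (i, i))`_0.

Fact ecoefP i c x y : ecoef i (c *: x + y) = c * ecoef i x + ecoef i y.
Proof. by rewrite /ecoef !ffunE coefD coefZ. Qed.

Fact ecoefM i (y x : Calg) : ecoef i (y * x) = ecoef i y * ecoef i x.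
Proof.
rewrite /ecoef ffunE coef_sum (bigD1 i) //= big1 => [|j ji].
  by rewrite /comp delta_iij expr0 mul1r addr0 coef0M.
rewrite /comp coefXnM delta_iji; case: ifPn => // dij.
suff : (j : nat) = i by move/val_inj/eqP; rewrite (negbTE ji).
by lia.
Qed.

Lemma ecoef_abas i l j a :
  ecoef i (abas l j a) = [&& j == i, l == i & a == 0%N]%:R.
Proof.
rewrite /ecoef ffunE xpair_eqE ![i == _]eq_sym.
have [_|_] := eqVneq j i; have [_|_] := eqVneq l i; rewrite ?coef0 //=.
by rewrite coefXn eq_sym.
Qed.

Fact ecoef1 i : ecoef i 1 = 1.
Proof. by rewrite /ecoef Calg_oneE eqxx coef1. Qed.

(* The one-dimensional bimodule on eps_i, which is 1 : k *)
Definition S_bimod (i : obj) : bimodule Calg.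
Proof.
apply: (@Bimodule k Calg k^o (fun x m => ecoef i x * m)
                             (fun m x => m * ecoef i x)).
- by move=> c x y m; rewrite ecoefP mulrDl -mulrA.
- by move=> x c m n; rewrite mulrDr; congr (_ + _); apply: mulrCA.
- by move=> c m n x; rewrite mulrDl; congr (_ + _); rewrite -mulrA.
- by move=> m c x y; rewrite ecoefP mulrDr; congr (_ + _); apply: mulrCA.
- by move=> m; rewrite ecoef1 mul1r.
- by move=> m; rewrite ecoef1 mulr1.
- by move=> x y m; rewrite ecoefM mulrA.
- by move=> m x y; rewrite ecoefM mulrA.
- by move=> x m y; rewrite mulrA.
Defined.

Fact pi_subproof i :
  is_bimod_hom (fun x : diagonal Calg => ecoef i x : S_bimod i).
Proof. by split; [exact: ecoefP | exact: ecoefM | exact: ecoefM]. Qed.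
Definition pi_hom (i : obj) : bimod_hom (diagonal Calg) (S_bimod i) :=
  to_submod (S := bimod_homs _ _) (pi_subproof i).

(* By ecoef_abas the ideal spanned by the basis elements other than e_i *)
Definition B_bimod (i : obj) : bimodule Calg := bimod_ker (pi_hom i).

End Category.

Section PreNat.
Variables (k : fieldType) (N : nat) (M : bimodule (Calg k N)).

(* A composable chain X_0 -> X_1 -> ... -> X_d of morphisms of C is given by
   its source X_0 and the sequence (X_1, a_1), ..., (X_d, a_d), where a_r is
   in Hom(X_(r-1), X_r).                                                      *)
Definition chain := seq (obj N * {poly k}).
Implicit Types (x y z : obj N) (a b : {poly k}) (s t : chain).

Definition target x s : obj N := last x (map fst s).

(* Replaces the arrows a_(l+1), a_(l+2) of the chain by their composite. *)
Fixpoint contract (l : nat) x s : chain :=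
  match s, l with
  | (y, a) :: (z, b) :: s', 0 => (z, comp x y z b a) :: s'
  | (y, a) :: s', l'.+1 => (y, a) :: contract l' y s'
  | _, _ => s
  end.

(* A functor from C to (right) modules which sends T_j to e_j M has as its
   pre-natural transformations from the Yoneda functor the sequences (T^d),
   T^d : Hom(X_(d-1), X_d) (x) ... (x) Hom(X_0, X_1) -> e_{X_d} M e_{X_0}.
   As everything sits in degree 0, those of degree d have T^d as their only
   component; f x s stands for T^d(a_d, ..., a_1).                            *)
Definition is_prenat (d : nat) (f : obj N -> chain -> M) : Prop :=
  [/\ forall x s, size s != d -> f x s = 0,
      forall x s,
        lact (idem k (target x s)) (ract (f x s) (idem k x)) = f x s &
      forall x s y (c : k) a b t,
        f x (s ++ (y, c *: a + b) :: t) =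
        c *: f x (s ++ (y, a) :: t) + f x (s ++ (y, b) :: t)].

Fact prenat0 d : is_prenat d 0.
Proof.
by split=> // *; rewrite ?ract0l ?lact0r // scaler0 addr0.
Qed.
Fact prenatP d (c : k) f g :
  is_prenat d f -> is_prenat d g -> is_prenat d (c *: f + g).
Proof.
have E x s : (c *: f + g) x s = c *: f x s + g x s by [].
move=> [f1 f2 f3] [g1 g2 g3]; split=> *; rewrite !E.
- by rewrite f1 // g1 // scaler0 addr0.
- by rewrite ractPl lactPr f2 g2.
- rewrite f3 g3 !scalerDr !scalerA (mulrC c) -!addrA; congr (_ + _).
  by rewrite addrCA.
Qed.
Definition prenat_space d : subspace (obj N -> chain -> M) :=
  @Subspace k _ (@is_prenat d) (@prenat0 d) (@prenatP d).
Definition prenat d := submod (prenat_space d).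
HB.instance Definition _ d := GRing.Lmodule.on (prenat d).

(* mu^1 on pre-natural transformations, up to an overall sign on each degree,
   which changes neither cocycles nor coboundaries: f is composed with the
   first arrow of the chain, with two consecutive ones, with the last one. *)
Definition prenat_diff_fun (f : obj N -> chain -> M) x s : M :=
  if s is (y, a) :: s' then
      ract (f y s') (emb x y a)
    + \sum_(l < size s') (-1) ^+ l.+1 *: f x (contract l x s)
    + (-1) ^+ size s *: lact
        (emb (target x (take (size s') s)) (target x s) (last (y, a) s').2)
        (f x (take (size s') s))
  else 0.

(* A recursive form of all terms but the first of prenat_diff_fun *)
Fixpoint pd_rec (f : chain -> M) x s : M :=
  if s is (y, a) :: s' then
    - (if s' is (z, b) :: s'' then f ((z, comp x y z b a) :: s'')
       else lact (emb x y a) (f [::]))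
    - pd_rec (fun t => f ((y, a) :: t)) y s'
  else 0.

Lemma pd_rec_cons2 f x y a z b s :
  pd_rec f x ((y, a) :: (z, b) :: s) =
  - f ((z, comp x y z b a) :: s) -
    pd_rec (fun t => f ((y, a) :: t)) y ((z, b) :: s).
Proof. by []. Qed.

Lemma prenat_diff_cons f x y a s :
  prenat_diff_fun f x ((y, a) :: s) =
  ract (f y s) (emb x y a) + pd_rec (f x) x ((y, a) :: s).
Proof.
rewrite /prenat_diff_fun -addrA; congr (_ + _); move: (f x) => {}f.
elim: s f x y a => [|[z b] s IH] f x y a.
  by rewrite /= big_ord0 add0r subr0 expr1 scaleN1r.
rewrite big_ord_recl expr1 scaleN1r -addrA.
rewrite pd_rec_cons2; congr (_ + _).
rewrite -(IH (fun t => f ((y, a) :: t))) opprD; congr (_ + _).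
  rewrite -sumrN; apply: eq_bigr => l _.
  by rewrite exprS mulN1r scaleNr.
by rewrite [size _]/= exprS mulN1r scaleNr.
Qed.

Lemma pd_rec_ext f g x s :
  (forall t, size s = (size t).+1 -> f t = g t) -> pd_rec f x s = pd_rec g x s.
Proof.
elim: s f g x => [|[y a] s IH] f g x fg //=.
congr (- _ - _).
  by case: s {IH} fg => [|[z b] s] fg; rewrite fg.
by apply: IH => t ht; apply: fg; rewrite /= ht.
Qed.

Lemma pd_recP f g c x s :
  pd_rec (fun t => c *: f t + g t) x s = c *: pd_rec f x s + pd_rec g x s.
Proof.
elim: s f g x => [|[y a] s IH] f g x /=; first by rewrite scaler0 addr0.
rewrite IH scalerBr scalerN !opprD.
rewrite [RHS]addrACA; congr (_ + _).
by case: s {IH} => [|[z b] s]; rewrite ?lactPr opprD.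
Qed.

Lemma pd_rec0 x s : pd_rec (fun=> 0) x s = 0.
Proof.
elim: s x => [//|[y a] s IH] x /=; rewrite IH subr0.
by case: s {IH} => [|[z b] s]; rewrite ?lact0r oppr0.
Qed.

Lemma pd_recN f x s : pd_rec (fun t => - f t) x s = - pd_rec f x s.
Proof.
have := pd_recP f (fun=> 0) (-1) x s; rewrite pd_rec0 addr0 scaleN1r => <-.
by apply: pd_rec_ext => t _; rewrite addr0 scaleN1r.
Qed.

Lemma pd_recB f g x s :
  pd_rec (fun t => f t - g t) x s = pd_rec f x s - pd_rec g x s.
Proof.
have := pd_recP g f (-1) x s; rewrite scaleN1r addrC => <-.
by apply: pd_rec_ext => t _; rewrite scaleN1r addrC.
Qed.

Lemma pd_rec_ract f x s (u : Calg k N) :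
  pd_rec (fun t => ract (f t) u) x s = ract (pd_rec f x s) u.
Proof.
elim: s f x => [|[y a] s IH] f x /=; first by rewrite ract0l.
rewrite IH ractDl !ractNl; congr (- _ - _).
by case: s {IH} => [|[z b] s] //; rewrite lract.
Qed.

Lemma pd_rec2 f x s : pd_rec (pd_rec f x) x s = 0.
Proof.
elim: s f x => [|[y a] s IH] f x //=.
case: s IH => [|[z b] s] IH.
  by rewrite lact0r subr0 oppr0.
pose h t := pd_rec f x ((y, a) :: t).
have E : pd_rec h y ((z, b) :: s) =
   - pd_rec (fun t => if t is (w, c) :: t' then f ((w, comp x y w c a) :: t')
       else lact (emb x y a) (f [::])) y ((z, b) :: s).
  rewrite -[RHS]subr0 -(IH (fun t => f ((y, a) :: t)) y) -pd_recN -pd_recB.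
  by apply: pd_rec_ext.
rewrite -/h E opprK; apply/eqP; rewrite addrC subr_eq0; apply/eqP.
rewrite /=; case: s {IH h E} => [|[w c] s] /=.
  by rewrite !subr0 -lactM emb_mul.
by rewrite compA.
Qed.

Lemma prenat_diff_fun2 f : prenat_diff_fun (prenat_diff_fun f) = 0.
Proof.
apply/funext => x; apply/funext => -[//|[y a] s].
rewrite prenat_diff_cons -[RHS]/0.
case: s => [|[z b] s].
  by rewrite /= ract0l lact0r !oppr0 !addr0.
rewrite prenat_diff_cons ractDl -ractM emb_mul.
pose g t := if t is (w, c) :: t' then ract (f w t') (emb x w c) else 0.
have -> : pd_rec (prenat_diff_fun f x) x [:: (y, a), (z, b) & s] =
    pd_rec g x [:: (y, a), (z, b) & s].
  rewrite -[RHS]addr0 -(pd_rec2 (f x) x [:: (y, a), (z, b) & s]).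
  rewrite -[X in _ + X]opprK -pd_recN -pd_recB; apply: pd_rec_ext.
  by case=> [|[w c] t] // _; rewrite prenat_diff_cons opprK.
rewrite pd_rec_cons2.
have -> : pd_rec (fun t => g ((y, a) :: t)) y ((z, b) :: s) =
    ract (pd_rec (f y) y ((z, b) :: s)) (emb x y a) by exact: pd_rec_ract.
by rewrite -opprD subrr.
Qed.

Lemma emb_idemr x y a : emb x y a * idem k x = emb x y a.
Proof. by rewrite emb_mul /comp delta_iij expr0 mul1r mulr1. Qed.

Lemma emb_ideml x y a : idem k y * emb x y a = emb x y a.
Proof. by rewrite emb_mul /comp delta_ijj expr0 !mul1r. Qed.

Lemma pd_rec_size n f x s : (forall t, size t != n -> f t = 0) ->
  size s != n.+1 -> pd_rec f x s = 0.
Proof.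
move=> f0 sn; rewrite -(pd_rec0 x s); apply: pd_rec_ext => t st; apply: f0.
by apply: contra sn => /eqP <-; rewrite st.
Qed.

Lemma pd_rec_typed (u : Calg k N) f x s :
  (forall t, lact (idem k (target x t)) (ract (f t) u) = f t) ->
  lact (idem k (target x s)) (ract (pd_rec f x s) u) = pd_rec f x s.
Proof.
elim: s f x => [|[y a] s IH] f x fu; first by rewrite /= ract0l lact0r.
rewrite /= ractDl lactDr !ractNl !lactNr; congr (- _ - _); last first.
  by apply: IH => t; exact: (fu ((y, a) :: t)).
case: s {IH} => [|[z b] s]; last exact: (fu ((z, comp x y z b a) :: s)).
rewrite -lract -lactM emb_ideml -[in RHS](fu [::]).
by rewrite -lactM emb_idemr.
Qed.

Definition multilin (f : chain -> M) := forall s y (c : k) a b t,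
  f (s ++ (y, c *: a + b) :: t) =
  c *: f (s ++ (y, a) :: t) + f (s ++ (y, b) :: t).

Lemma comp_linearl x y z c a a' b :
  comp x y z (c *: a + a') b = c *: comp x y z a b + comp x y z a' b.
Proof. by rewrite /comp mulrDl mulrDr -scalerAl -scalerAr. Qed.

Lemma comp_linearr x y z c a a' b :
  comp x y z b (c *: a + a') = c *: comp x y z b a + comp x y z b a'.
Proof. by rewrite /comp !mulrDr -!scalerAr. Qed.

Lemma pd_rec_multilin f x : multilin f -> multilin (pd_rec f x).
Proof.
move=> fm s y c a b t; elim: s f x fm => [|[y1 a1] s IH] f x fm.
  have E : pd_rec (fun t => f ((y, c *: a + b) :: t)) y t =
      c *: pd_rec (fun t => f ((y, a) :: t)) y t
      + pd_rec (fun t => f ((y, b) :: t)) y t.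
    by rewrite -pd_recP; apply: pd_rec_ext => t' _; exact: (fm [::]).
  rewrite /= E scalerBr scalerN !opprD [RHS]addrACA; congr (_ + _).
  case: t {E} => [|[z a'] t].
    by rewrite emb_linear lactPl opprD ?scalerN.
  by rewrite comp_linearr (fm [::]) opprD ?scalerN.
have fm1 : multilin (fun t => f ((y1, a1) :: t)).
  by move=> s' *; exact: (fm ((y1, a1) :: s')).
rewrite !cat_cons /= (IH (fun t => f ((y1, a1) :: t))) // scalerBr !opprD.
rewrite [RHS]addrACA; congr (_ + _).
case: s {IH} => [|[z a'] s] /=.
  by rewrite comp_linearl (fm [::]) opprD ?scalerN.
by rewrite (fm ((z, comp x y1 z a' a1) :: s)) opprD ?scalerN.
Qed.

Lemma target_cat x s y a b t :
  target x (s ++ (y, a) :: t) = target x (s ++ (y, b) :: t).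
Proof. by rewrite /target !map_cat. Qed.

Fact prenat_diff_subproof d (f : prenat d) :
  is_prenat d.+1 (prenat_diff_fun (val f)).
Proof.
have [f1 f2 f3] : is_prenat d (val f) by exact: submodP (f : prenat d).
move: (val f) f1 f2 f3 => {}f f1 f2 f3; split.
- move=> x [//|[y a] s] sd; rewrite prenat_diff_cons f1 // ract0l add0r.
  exact: pd_rec_size (f1 x) sd.
- move=> x [|[y a] s]; first by rewrite /= ract0l lact0r.
  rewrite prenat_diff_cons ractDl lactDr (pd_rec_typed _ (f2 x)).
  congr (_ + _); rewrite -ractM emb_idemr lract; congr (ract _ _).
  rewrite -[in RHS](f2 y s) -[in LHS](f2 y s) -lactM emb_mul.
  by rewrite /comp delta_iij expr0 !mul1r.
- move=> x [|[y1 a1] s] y c a b t; rewrite ?cat_cons !prenat_diff_cons.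
    rewrite (pd_rec_multilin x (f3 x) [::]) emb_linear ractPr.
    by rewrite [LHS]addrACA -scalerDr.
  rewrite -!cat_cons (pd_rec_multilin x (f3 x)) f3 ractPl.
  by rewrite [LHS]addrACA -scalerDr.
Qed.
Definition prenat_diff d (f : prenat d) : prenat d.+1 :=
  to_submod (S := prenat_space d.+1) (prenat_diff_subproof f).

Lemma prenat_diff_funP (c : k) f g :
  prenat_diff_fun (c *: f + g) = c *: prenat_diff_fun f + prenat_diff_fun g.
Proof.
apply/funext => x; apply/funext => -[|[y a] s].
  by change (0 = c *: 0 + 0 :> M); rewrite scaler0 addr0.
change (prenat_diff_fun (c *: f + g) x ((y, a) :: s) =
  c *: prenat_diff_fun f x ((y, a) :: s) + prenat_diff_fun g x ((y, a) :: s)).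
rewrite !prenat_diff_cons.
have -> : pd_rec ((c *: f + g) x) x ((y, a) :: s) =
    c *: pd_rec (f x) x ((y, a) :: s) + pd_rec (g x) x ((y, a) :: s).
  exact: pd_recP.
have -> : (c *: f + g) y s = c *: f y s + g y s by [].
by rewrite ractPl [LHS]addrACA -scalerDr.
Qed.

Fact prenat_diff_linear d : linear (@prenat_diff d).
Proof.
move=> c f g; apply: val_inj.
rewrite [RHS]submod_valP /=.
exact: (prenat_diff_funP c (submod_val f) (submod_val g)).
Qed.
HB.instance Definition _ d := GRing.isLinear.Build k _ _ _ (@prenat_diff d)
  (@prenat_diff_linear d).

Fact prenat_diff2 d f : prenat_diff (@prenat_diff d f) = 0.
Proof. by apply: val_inj; exact: prenat_diff_fun2. Qed.

Definition prenat_complex : cochain_complex k :=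
  @CochainComplex k (fun d => prenat d : lmodType k)
    (fun d => @prenat_diff d) prenat_diff2.

(* H^n Hom(id, F_M), where F_M is the functor of the bimodule M *)
Definition HNat n : lmodType k := cohomology prenat_complex n.

End PreNat.

(* The direct sum of copies of k indexed by the integers l >= m *)
Definition ksum_ge (k : fieldType) (m : nat) : lmodType k :=
  {malg k[{l : nat | (m <= l)%N}]}.

Definition HH_value (k : fieldType) (N n : nat) : lmodType k :=
  match n with
  | 0 => ksum_ge k 1
  | 1 => ksum_ge k 0
  | 2 => 'rV[k]_(N - 2)
  | _ => 'rV[k]_0
  end.

(* Main.v *)
From HB Require Import structures.
From mathcomp Require Import all_boot all_order all_algebra.
From mathcomp Require Import boolp functions.
From mathcomp Require Import finmap monalg.
From mathcomp Require Import zify.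
Require Import Defs.

Set Implicit Arguments.
Unset Strict Implicit.
Unset Printing Implicit Defensive.

Import GRing.Theory.
Local Open Scope ring_scope.
Local Open Scope quotient_scope.

(** The three sides of the statement are computed by three complexes which depend
    functorially on a bimodule M: the pre-natural transformations, the bimodule
    maps out of a projective resolution of the diagonal, and a Koszul complex with
    terms in degrees 0, 1 and 2 only. They have the same cohomology because each
    is a universal delta-functor on bimodules with the same degree 0. Concretely,
    M embeds into the coinduced bimodule Hom_k(A, M), whose cohomology vanishes
    in positive degrees for each of the three, and the quotient, the cosyzygy of
    M, has the cohomology of M shifted by one; in degree 0 all three give the
    central elements of M. This is theory_unique, and the vanishing has a separate
    reason in each case.

    - For a projective resolution, bimodule maps into Hom_k(A, M) are left module
      maps into M, and a projective resolution of A splits over the left action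
      (resolution_left_split).
    - For pre-natural transformations, the argument y in A of a value in
      Hom_k(A, M) serves as an additional first arrow of the chain, which gives
      the usual contraction of the bar complex (prenat_coind_acyclic).
    - The algebra A is that of the quiver with arrows in both directions between s
      and s + 1, modulo the equality of the two loops of length 2 at each vertex j
      with 0 < j < N. Its basis element a_{ti} s^b is the common value of all paths
      of length |t - i| + 2b from i to t, so that a Koszul cochain with values in
      Hom_k(A, M) is a cochain on the planar complex with a vertex (p, t) for each
      such endpoint and length, and one square for each relation. A closed
      1-cochain is integrated along the paths which step down from t + 1 to t
      whenever possible (primitive_step), and a 2-cochain is a coboundary because
      each square is the only one ending at its last vertex
      (koszul_coind_acyclic2).

    Since Hom(T_s, T_t) is a copy of k[s], the Koszul complex of the diagonal is
      (z_t) |-> psi_{st} = z_s - z_t   and   psi |-> chi_j = s (g_j - g_{j-1}),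
    where g_j is the sum of psi over the two arrows between j and j + 1. Passing
    to the ideal spanned by the basis elements other than e_i requires z_i and
    chi_i to be divisible by s. Hence H^0 consists of the constant families in
    s k[s], H^1 is the space k[s] of common values of the g_j, and H^2 records the
    constant terms of the chi_j with 0 < j < N and j <> i, which are N - 2
    scalars. *)

(** * Linear isomorphisms given by relations *)

Definition linear_rel (k : fieldType) (U V : lmodType k)
    (R : U -> V -> Prop) : Prop :=
  forall c u v u' v', R u v -> R u' v' -> R (c *: u + u') (c *: v + v').

Lemma lin_iso_rel (k : fieldType) (U V : lmodType k) (R : U -> V -> Prop) :
  linear_rel R ->
  (forall u, exists v, R u v) -> (forall v, exists u, R u v) ->
  (forall v, R 0 v -> v = 0) -> (forall u, R u 0 -> u = 0) ->
  lin_isomorphic U V.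
Proof.
move=> Rlin totl totr R0 Rr0.
have [f fP] := choice totl; have [g gP] := choice totr.
have Rl u v v' : R u v -> R u v' -> v = v'.
  move=> h h'; apply/eqP; rewrite -subr_eq0; apply/eqP/R0.
  have := Rlin (-1) _ _ _ _ h' h.
  by rewrite scaleN1r addNr scaleN1r addrC.
have Rr u u' v : R u v -> R u' v -> u = u'.
  move=> h h'; apply/eqP; rewrite -subr_eq0; apply/eqP/Rr0.
  have := Rlin (-1) _ _ _ _ h' h.
  by rewrite !scaleN1r addNr addrC.
have flin : linear f by move=> c u v; apply: Rl (fP _) _; exact: Rlin.
pose F := GRing.isLinear.Build k _ _ _ f flin.
exists (HB.pack_for {linear U -> V} f F), g => [u|v] /=.
  exact: Rr (gP _) (fP _).
exact: Rl (fP _) (gP _).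
Qed.

Lemma lin_iso_sym (k : fieldType) (U V : lmodType k) :
  lin_isomorphic U V -> lin_isomorphic V U.
Proof.
move=> [f [g fK gK]]; apply: (lin_iso_rel (R := fun v u => f u = v)).
- by move=> c v u v' u' <- <-; rewrite linearP.
- by move=> v; exists (g v).
- by move=> u; exists (f u).
- by move=> u fu; rewrite -[u]fK fu -(raddf0 f) fK.
- by move=> v <-; rewrite raddf0.
Qed.

Lemma lin_iso_trans (k : fieldType) (U V W : lmodType k) :
  lin_isomorphic U V -> lin_isomorphic V W -> lin_isomorphic U W.
Proof.
move=> [f f_bij] [g g_bij].
by exists (g \o f : {linear U -> W}); exact: bij_comp.
Qed.

Section CohomologyClass.
Variables (k : fieldType) (C : cochain_complex k) (n : nat).

Definition cohom_class (u : cc_obj C n) (h : cohomology C n) : Prop :=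
  exists w : submod (cocycles C n), val w = u /\ quotmod_pi _ w = h.

Lemma cohom_class_linear : linear_rel cohom_class.
Proof.
move=> c u h u' h' [w [<- <-]] [w' [<- <-]].
exists (c *: w + w'); split; first exact: submod_valP.
exact: quotmod_pi_linear.
Qed.

Lemma cohom_class_ex u : cc_diff C n u = 0 -> exists h, cohom_class u h.
Proof.
move=> du; pose w : submod (cocycles C n) := to_submod (S := cocycles C n) du.
by exists (quotmod_pi _ w), w.
Qed.

Lemma cohom_class_surj h :
  exists2 u, cc_diff C n u = 0 & cohom_class u h.
Proof.
pose w : submod (cocycles C n) := repr h.
exists (val w); first exact: (submodP w).
by exists w; split=> //; exact: quotmod_piK.
Qed.

Lemma cohom_class0 u h : cohom_class u h -> is_coboundary u <-> h = 0.
Proof.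
move=> [w [<- <-]]; rewrite -(raddf0 (quotmod_pi (coboundaries C n))).
by rewrite quotmod_piP subr0.
Qed.

End CohomologyClass.

(** A connecting homomorphism, or its inverse, is only a relation between
    cochains; this says when such a relation induces an isomorphism. *)
Lemma cohomology_iso_rel (k : fieldType) (C D : cochain_complex k) n m
    (R : cc_obj C n -> cc_obj D m -> Prop) :
  linear_rel R ->
  (forall u, cc_diff C n u = 0 -> exists2 v, cc_diff D m v = 0 & R u v) ->
  (forall v, cc_diff D m v = 0 -> exists2 u, cc_diff C n u = 0 & R u v) ->
  (forall u v, cc_diff C n u = 0 -> cc_diff D m v = 0 -> R u v ->
     is_coboundary u <-> is_coboundary v) ->
  lin_isomorphic (cohomology C n) (cohomology D m).
Proof.
move=> Rlin totl totr Rbd.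
pose S h g := exists u v, [/\ cc_diff C n u = 0, cc_diff D m v = 0, R u v,
  cohom_class u h & cohom_class v g].
have S0 h g : S h g -> h = 0 <-> g = 0.
  move=> [u [v [du dv r uh vg]]].
  by rewrite -(cohom_class0 uh) -(cohom_class0 vg); exact: Rbd.
apply: (lin_iso_rel (R := S)).
- move=> c h g h' g' [u [v [du dv r uh vg]]] [u' [v' [du' dv' r' uh' vg']]].
  exists (c *: u + u'), (c *: v + v'); split.
  + by rewrite linearP du du' scaler0 addr0.
  + by rewrite linearP dv dv' scaler0 addr0.
  + exact: Rlin.
  + exact: cohom_class_linear.
  + exact: cohom_class_linear.
- move=> h; have [u du uh] := cohom_class_surj h.
  have [v dv r] := totl u du; have [g vg] := cohom_class_ex dv.
  by exists g, u, v.
- move=> g; have [v dv vg] := cohom_class_surj g.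
  have [u du r] := totr v dv; have [h uh] := cohom_class_ex du.
  by exists h, u, v.
- by move=> g /S0 [/(_ erefl)].
- by move=> h /S0 [_ /(_ erefl)].
Qed.

(** The same with a module known explicitly on the right. *)
Lemma cohomology_iso_mod (k : fieldType) (C : cochain_complex k) n
    (W : lmodType k) (R : cc_obj C n -> W -> Prop) :
  linear_rel R ->
  (forall u, cc_diff C n u = 0 -> exists w, R u w) ->
  (forall w, exists2 u, cc_diff C n u = 0 & R u w) ->
  (forall u w, cc_diff C n u = 0 -> R u w -> is_coboundary u <-> w = 0) ->
  lin_isomorphic (cohomology C n) W.
Proof.
move=> Rlin totl totr Rbd.
pose S h w := exists u, [/\ cc_diff C n u = 0, R u w & cohom_class u h].
have S0 h w : S h w -> h = 0 <-> w = 0.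
  by move=> [u [du r uh]]; rewrite -(cohom_class0 uh); exact: Rbd.
apply: (lin_iso_rel (R := S)).
- move=> c h w h' w' [u [du r uh]] [u' [du' r' uh']].
  exists (c *: u + u'); split; last exact: cohom_class_linear.
    by rewrite linearP du du' scaler0 addr0.
  exact: Rlin.
- move=> h; have [u du uh] := cohom_class_surj h.
  by have [w r] := totl u du; exists w, u.
- move=> w; have [u du r] := totr w.
  by have [h uh] := cohom_class_ex du; exists h, u.
- by move=> g /S0 [/(_ erefl)].
- by move=> h /S0 [_ /(_ erefl)].
Qed.
(** * Coinduced bimodules and quotients *)

Lemma bhomN (k : fieldType) (A : algType k) (M N : bimodule A)
  (f : bimod_hom M N) m : f (- m) = - f m.
Proof. by have := bhomP f (-1) m 0; rewrite bhom0 !addr0 !scaleN1r. Qed.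

Section Coinduced.
Variables (k : fieldType) (A : algType k).
Implicit Types M N : bimodule A.

Lemma linear_fun0 M : linear (0 : A -> M).
Proof. by move=> c x y; change (0 = c *: 0 + 0 :> M); rewrite scaler0 addr0. Qed.

Lemma linear_funP M (c : k) (f g : A -> M) :
  linear f -> linear g -> linear (c *: f + g).
Proof.
move=> fl gl d x y.
change (c *: f (d *: x + y) + g (d *: x + y) =
        d *: (c *: f x + g x) + (c *: f y + g y)).
rewrite fl gl !scalerDr !scalerA (mulrC d) -!addrA; congr (_ + _).
by rewrite addrCA.
Qed.

Definition linear_funs M : subspace (A -> M) :=
  @Subspace k _ (fun f => linear f) (@linear_fun0 M) (@linear_funP M).

Definition coind_of M (f : A -> M) (fl : linear f) : submod (linear_funs M) :=
  to_submod (S := linear_funs M) fl.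

Lemma coind_linear M (f : submod (linear_funs M)) : linear (val f).
Proof. exact: (submodP f). Qed.

Lemma coind_valP M c (f g : submod (linear_funs M)) y :
  val (c *: f + g) y = c *: val f y + val g y.
Proof. exact: (congr1 (fun h : A -> M => h y) (submod_valP c f g)). Qed.

Fact coind_lact_linear M (x : A) (f : submod (linear_funs M)) :
  linear (fun y => lact x (val f y)).
Proof. by move=> c y z; rewrite coind_linear lactPr. Qed.
Fact coind_ract_linear M (f : submod (linear_funs M)) (x : A) :
  linear (fun y => val f (x * y)).
Proof. by move=> c y z; rewrite mulrDr -scalerAr coind_linear. Qed.

(** Hom_k(A, M), coinduced from the left module M: evaluation at 1 turns the
    bimodule maps from P to it into the left module maps from P to M. *)
Definition coind M : bimodule A.
Proof.
apply: (@Bimodule k A (submod (linear_funs M))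
  (fun x f => coind_of (coind_lact_linear x f))
  (fun f x => coind_of (coind_ract_linear f x))).
- move=> c x y m; apply: val_inj; rewrite [RHS]submod_valP /=.
  by apply/funext => z; exact: lactPl.
- move=> x c m n; apply: val_inj; rewrite [RHS]submod_valP /=.
  apply/funext => z; apply: etrans (lactPr x c (val m z) (val n z)).
  exact: (congr1 (lact x) (coind_valP c m n z)).
- move=> c m n x; apply: val_inj; rewrite [RHS]submod_valP /=.
  by apply/funext => z; exact: coind_valP.
- move=> m c x y; apply: val_inj; rewrite [RHS]submod_valP /=.
  apply/funext => z; change (submod_val m ((c *: x + y) * z) =
    c *: submod_val m (x * z) + submod_val m (y * z)).
  by rewrite mulrDl -scalerAl; exact: coind_linear.
- by move=> m; apply/val_inj/funext => z; exact: lact1.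
- by move=> m; apply/val_inj/funext => z /=; rewrite mul1r.
- by move=> x y m; apply/val_inj/funext => z; exact: lactM.
- by move=> m x y; apply/val_inj/funext => z /=; rewrite mulrA.
- by move=> x m y; apply: val_inj.
Defined.

Definition cofun M (f : coind M) : A -> M := submod_val f.

Definition mk_coind M (f : A -> M) (fl : linear f) : coind M := coind_of fl.

Lemma cofunE M (f : A -> M) (fl : linear f) y : cofun (mk_coind fl) y = f y.
Proof. by []. Qed.
Lemma cofunP M (f : coind M) c x y :
  cofun f (c *: x + y) = c *: cofun f x + cofun f y.
Proof. exact: coind_linear. Qed.
Lemma cofun_lact M (f : coind M) x y : cofun (lact x f) y = lact x (cofun f y).
Proof. by []. Qed.
Lemma cofun_ract M (f : coind M) x y : cofun (ract f x) y = cofun f (x * y).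
Proof. by []. Qed.
Lemma cofunPl M c (f g : coind M) y :
  cofun (c *: f + g) y = c *: cofun f y + cofun g y.
Proof. exact: coind_valP. Qed.
Lemma cofun_inj M (f g : coind M) : (forall y, cofun f y = cofun g y) -> f = g.
Proof. by move=> h; apply/val_inj/funext => y; exact: h. Qed.
Lemma cofun0 M y : cofun (0 : coind M) y = 0.
Proof. by []. Qed.

Lemma linear_fun_0 M (f : A -> M) : linear f -> f 0 = 0.
Proof.
by move=> fl; have := fl (-1) 0 0; rewrite !scaleN1r oppr0 addr0 addNr.
Qed.
Lemma cofun_0r M (f : coind M) : cofun f 0 = 0.
Proof. exact/linear_fun_0/cofunP. Qed.

Fact coind_unit_linear M (m : M) : linear (fun y => ract m y).
Proof. by move=> c x y; rewrite ractPr. Qed.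
Fact coind_unit_subproof M :
  is_bimod_hom (fun m : M => mk_coind (coind_unit_linear m)).
Proof.
split=> [c m n|x m|m x]; apply: cofun_inj => y.
- by rewrite cofunPl !cofunE ractPl.
- by rewrite cofun_lact !cofunE lract.
- by rewrite cofun_ract !cofunE ractM.
Qed.
Definition coind_unit M : bimod_hom M (coind M) :=
  to_submod (S := bimod_homs M (coind M)) (coind_unit_subproof M).

Lemma coind_unitE M (m : M) y : cofun (coind_unit M m) y = ract m y.
Proof. by []. Qed.

Lemma coind_unit1 M (m : M) : cofun (coind_unit M m) 1 = m.
Proof. by rewrite coind_unitE ract1. Qed.

Lemma coind_unit_inj M : injective (coind_unit M).
Proof. by move=> m n mn; rewrite -[m]coind_unit1 mn coind_unit1. Qed.

Fact image_space0 M N (f : bimod_hom M N) : exists m, f m = 0.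
Proof. by exists 0; exact: bhom0. Qed.
Fact image_spaceP M N (f : bimod_hom M N) (c : k) u v :
  (exists m, f m = u) -> (exists m, f m = v) -> exists m, f m = c *: u + v.
Proof. by move=> [m <-] [n <-]; exists (c *: m + n); exact: bhomP. Qed.
Definition image_space M N (f : bimod_hom M N) : subspace N :=
  @Subspace k N (fun u => exists m, f m = u)
    (image_space0 f) (@image_spaceP M N f).

Section Cokernel.
Variables (M N : bimodule A) (f : bimod_hom M N).
Let S := image_space f.

Definition coker_lact (x : A) (q : quotmod S) : quotmod S :=
  quotmod_pi S (lact x (repr q)).
Definition coker_ract (q : quotmod S) (x : A) : quotmod S :=
  quotmod_pi S (ract (repr q) x).

Lemma coker_lactE x n : coker_lact x (quotmod_pi S n) = quotmod_pi S (lact x n).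
Proof.
apply/quotmod_piP; have /quotmod_piP [m fm] := quotmod_piK (quotmod_pi S n).
by exists (lact x m); rewrite bhom_lact fm lactDr lactNr.
Qed.
Lemma coker_ractE x n : coker_ract (quotmod_pi S n) x = quotmod_pi S (ract n x).
Proof.
apply/quotmod_piP; have /quotmod_piP [m fm] := quotmod_piK (quotmod_pi S n).
by exists (ract m x); rewrite bhom_ract fm ractDl ractNl.
Qed.

Definition bimod_coker : bimodule A.
Proof.
apply: (@Bimodule k A (quotmod S) coker_lact coker_ract).
- move=> c x y m; rewrite -[m]quotmod_piK !coker_lactE.
  by rewrite -quotmod_pi_linear lactPl.
- move=> x c m n; rewrite -[m]quotmod_piK -[n]quotmod_piK !coker_lactE.
  by rewrite -!quotmod_pi_linear coker_lactE lactPr.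
- move=> c m n x; rewrite -[m]quotmod_piK -[n]quotmod_piK !coker_ractE.
  by rewrite -!quotmod_pi_linear coker_ractE ractPl.
- move=> m c x y; rewrite -[m]quotmod_piK !coker_ractE.
  by rewrite -quotmod_pi_linear ractPr.
- by move=> m; rewrite -[m]quotmod_piK coker_lactE lact1.
- by move=> m; rewrite -[m]quotmod_piK coker_ractE ract1.
- by move=> x y m; rewrite -[m]quotmod_piK !coker_lactE lactM.
- by move=> m x y; rewrite -[m]quotmod_piK !coker_ractE ractM.
- move=> x m y; rewrite -[m]quotmod_piK.
  by rewrite coker_ractE !coker_lactE coker_ractE lract.
Defined.

Fact coker_proj_subproof : is_bimod_hom (quotmod_pi S : N -> bimod_coker).
Proof.
split=> [c m n|x m|m x]; first exact: quotmod_pi_linear.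
  exact/esym/coker_lactE.
exact/esym/coker_ractE.
Qed.
Definition coker_proj : bimod_hom N bimod_coker :=
  to_submod (S := bimod_homs N bimod_coker) coker_proj_subproof.

Lemma coker_projP n n' : coker_proj n = coker_proj n' <-> exists m, f m = n - n'.
Proof. exact: quotmod_piP. Qed.

Lemma coker_proj_surj : surjective_hom coker_proj.
Proof. by move=> q; exists (repr q); exact: quotmod_piK. Qed.

Lemma coker_proj0 n : coker_proj n = 0 <-> exists m, f m = n.
Proof.
rewrite -[n in X in _ <-> X]subr0 -coker_projP.
by rewrite (_ : coker_proj 0 = 0); [ | exact: bhom0].
Qed.
End Cokernel.

Definition cosyzygy M : bimodule A := bimod_coker (coind_unit M).
Definition cosyzygy_proj M : bimod_hom (coind M) (cosyzygy M) :=
  coker_proj (coind_unit M).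

(** Evaluation at 1 retracts the embedding into the coinduced bimodule, so that
    the quotient map has a section linear over k. *)
Lemma cosyzygy_section M : exists s : cosyzygy M -> coind M,
  linear s /\ forall q, cosyzygy_proj M (s q) = q.
Proof.
pose s (q : cosyzygy M) : coind M :=
  (repr q : coind M) - coind_unit M (cofun (repr q : coind M) 1).
have sE q (f : coind M) :
    cosyzygy_proj M f = q -> s q = f - coind_unit M (cofun f 1).
  move=> <-; rewrite /s.
  have [m mE] : exists m, coind_unit M m = f - repr (cosyzygy_proj M f).
    by apply/coker_projP; rewrite [RHS]quotmod_piK.
  set g := repr _ in mE *.
  have -> : cofun f 1 = m + cofun (g : coind M) 1.
    have := cofunPl 1 (coind_unit M m) (g : coind M) 1.
    by rewrite coind_unit1 !scale1r mE subrK.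
  by rewrite bhomD mE opprD opprB addrA [f + _]addrC subrK.
exists s; split=> [c q r|q]; last first.
  have [f fq] := coker_proj_surj q; rewrite (sE _ _ fq) -[in RHS]fq.
  apply/coker_projP; exists (- cofun f 1).
  have -> : f - coind_unit M (cofun f 1) - f = - coind_unit M (cofun f 1).
    by rewrite addrAC subrr sub0r.
  exact: bhomN.
have [f fq] := coker_proj_surj q; have [g gr] := coker_proj_surj r.
rewrite (sE _ _ fq) (sE _ _ gr) (sE _ (c *: f + g)); last by rewrite bhomP fq gr.
by rewrite cofunPl bhomP scalerBr opprD addrACA.
Qed.

End Coinduced.
(** * Uniqueness of bimodule cohomology *)

Section Theories.
Variables (k : fieldType) (A : algType k).

Definition central (M : bimodule A) (m : M) : Prop :=
  forall x : A, lact x m = ract m x.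

(** A universal delta-functor, given by complexes: ct_map_inj to ct_map_surj make
    M -> coind M -> cosyzygy M into a short exact sequence of complexes, and
    ct_acyclic makes its long exact sequence a dimension shift. The map ct_pt
    identifies the cohomology in degree 0 with the central elements; it is
    defined on all cochains of degree 0, so that it can be followed through the
    connecting homomorphism. *)
Record cohomology_theory := CohomologyTheory {
  ct_complex :> bimodule A -> cochain_complex k;
  ct_map : forall M N, bimod_hom M N -> forall n,
    cc_obj (ct_complex M) n -> cc_obj (ct_complex N) n;
  ct_mapP : forall M N (f : bimod_hom M N) n, linear (ct_map f (n := n));
  ct_map_diff : forall M N (f : bimod_hom M N) n u,
    cc_diff (ct_complex N) n (ct_map f u) = ct_map f (cc_diff _ n u);
  ct_map_inj : forall M N (f : bimod_hom M N) n, injective f ->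
    injective (ct_map f (n := n));
  ct_map_exact : forall M n u,
    ct_map (cosyzygy_proj M) (n := n) u = 0 ->
    exists v, ct_map (coind_unit M) v = u;
  ct_map_unit_proj : forall M n u,
    ct_map (cosyzygy_proj M) (ct_map (coind_unit M) (n := n) u) = 0;
  ct_map_surj : forall M n v,
    exists u, ct_map (cosyzygy_proj M) (n := n) u = v;
  ct_acyclic : forall M n u, cc_diff (ct_complex (coind M)) n.+1 u = 0 ->
    exists v, cc_diff _ n v = u;
  ct_pt : forall M, cc_obj (ct_complex M) 0 -> M;
  ct_ptP : forall M, linear (@ct_pt M);
  ct_pt_map : forall M N (f : bimod_hom M N) u, ct_pt (ct_map f u) = f (ct_pt u);
  ct_pt_central : forall M u, cc_diff (ct_complex M) 0 u = 0 -> central (ct_pt u);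
  ct_pt_surj : forall (M : bimodule A) (m : M), central m ->
    exists2 u, cc_diff (ct_complex M) 0 u = 0 & ct_pt u = m;
  ct_pt_inj : forall M u, cc_diff (ct_complex M) 0 u = 0 -> ct_pt u = 0 -> u = 0 }.

Section TheoryLemmas.
Variable T : cohomology_theory.

Lemma ct_map0 M N (f : bimod_hom M N) n : ct_map (c := T) f (0 : cc_obj (T M) n) = 0.
Proof.
have := ct_mapP f (n := n) (c := T) (-1) 0 0.
by rewrite !scaleN1r oppr0 addr0 addNr.
Qed.

Lemma ct_mapB M N (f : bimod_hom M N) n (u v : cc_obj (T M) n) :
  ct_map (c := T) f (u - v) = ct_map f u - ct_map f v.
Proof. by rewrite addrC -scaleN1r ct_mapP scaleN1r addrC. Qed.

Lemma ct_ptB M (u v : cc_obj (T M) 0) : ct_pt (c := T) (u - v) = ct_pt u - ct_pt v.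
Proof. by rewrite addrC -scaleN1r ct_ptP scaleN1r addrC. Qed.

Lemma ct_pt_eq M (u v : cc_obj (T M) 0) : cc_diff (T M) 0 u = 0 ->
  cc_diff (T M) 0 v = 0 -> ct_pt (c := T) u = ct_pt v -> u = v.
Proof.
move=> du dv uv; apply/eqP; rewrite -subr_eq0; apply/eqP.
apply: (ct_pt_inj (c := T)); first by rewrite linearB du dv subr0.
by rewrite ct_ptB uv subrr.
Qed.

(** The connecting homomorphism sends the class of the image of b in the quotient
    to the class of u. *)
Lemma connecting_cocycle M n (b : cc_obj (T (coind M)) n) u :
  ct_map (coind_unit M) u = cc_diff _ n b ->
  cc_diff (T (cosyzygy M)) n (ct_map (cosyzygy_proj M) b) = 0.
Proof. by move=> ub; rewrite ct_map_diff -ub ct_map_unit_proj. Qed.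

Lemma connecting_ex M n (u : cc_obj (T M) n.+1) : cc_diff (T M) n.+1 u = 0 ->
  exists b, ct_map (coind_unit M) u = cc_diff (T (coind M)) n b.
Proof.
move=> du; have [|b db] := ct_acyclic (c := T) (u := ct_map (coind_unit M) u).
  by rewrite ct_map_diff du ct_map0.
by exists b.
Qed.

Lemma connecting_surj M n (v : cc_obj (T (cosyzygy M)) n) :
  cc_diff (T (cosyzygy M)) n v = 0 -> exists b u,
  [/\ ct_map (cosyzygy_proj M) b = v, cc_diff (T M) n.+1 u = 0
    & ct_map (coind_unit M) u = cc_diff (T (coind M)) n b].
Proof.
move=> dv; have [b bv] := ct_map_surj (c := T) v.
have [|u ub] := ct_map_exact (c := T) (u := cc_diff (T (coind M)) n b).
  by rewrite -ct_map_diff bv dv.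
exists b, u; split=> //; apply: (ct_map_inj (c := T) (@coind_unit_inj _ _ M)).
by rewrite ct_map0 -ct_map_diff ub cc_diff2.
Qed.

Lemma connecting_coboundary M n (b b' : cc_obj (T (coind M)) n)
    (u : cc_obj (T M) n.+1) :
  ct_map (coind_unit M) u = cc_diff (T (coind M)) n b ->
  ct_map (cosyzygy_proj M) b = ct_map (cosyzygy_proj M) b' ->
  cc_diff (T (coind M)) n b' = 0 ->
  exists m, cc_diff (T M) n m = u.
Proof.
move=> ub bb' db'; have [|m mb] := ct_map_exact (c := T) (u := b - b').
  by rewrite ct_mapB bb' subrr.
exists m; apply: (ct_map_inj (c := T) (@coind_unit_inj _ _ M)).
by rewrite -ct_map_diff mb linearB db' subr0.
Qed.

End TheoryLemmas.

Lemma theory_iso0 (T T' : cohomology_theory) M :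
  lin_isomorphic (cohomology (T M) 0) (cohomology (T' M) 0).
Proof.
apply: (cohomology_iso_rel (R := fun u v => ct_pt (c := T) u = ct_pt (c := T') v)).
- by move=> c u v u' v' e e'; rewrite !ct_ptP e e'.
- move=> u du; have [v dv vu] := ct_pt_surj T' (ct_pt_central (c := T) du).
  by exists v.
- move=> v dv; have [u du vu] := ct_pt_surj T (ct_pt_central (c := T') dv).
  by exists u.
- have z (S : cohomology_theory) : ct_pt (c := S) (0 : cc_obj (S M) 0) = 0.
    by rewrite -(subrr 0) ct_ptB subrr.
  move=> u v du dv /= uv; split=> e.
    by apply: (ct_pt_inj (c := T')) => //; rewrite -uv e z.
  by apply: (ct_pt_inj (c := T)) => //; rewrite uv e z.
Qed.

(** A class of degree 1 is a central element of the cosyzygy modulo those which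
    lift to central elements of the coinduced bimodule, and this description
    makes no mention of the theory. *)
Lemma theory_iso1_half (T T' : cohomology_theory) M
    (u : cc_obj (T M) 1) (v : cc_obj (T' M) 1) b b' :
  ct_map (coind_unit M) u = cc_diff (T (coind M)) 0 b ->
  ct_map (coind_unit M) v = cc_diff (T' (coind M)) 0 b' ->
  ct_pt (ct_map (cosyzygy_proj M) b) = ct_pt (ct_map (cosyzygy_proj M) b') ->
  (exists m, cc_diff (T M) 0 m = u) -> exists m, cc_diff (T' M) 0 m = v.
Proof.
move=> ub vb bb' [m mu].
have dc : cc_diff (T (coind M)) 0 (b - ct_map (coind_unit M) m) = 0.
  by rewrite linearB -ub ct_map_diff mu subrr.
have [c' dc' cb] := ct_pt_surj T' (ct_pt_central dc).
apply: (connecting_coboundary vb _ dc').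
apply: ct_pt_eq; first exact: connecting_cocycle vb.
  by rewrite ct_map_diff dc' ct_map0.
by rewrite -bb' [RHS]ct_pt_map cb -ct_pt_map ct_mapB ct_map_unit_proj subr0.
Qed.

Lemma theory_iso1 (T T' : cohomology_theory) M :
  lin_isomorphic (cohomology (T M) 1) (cohomology (T' M) 1).
Proof.
pose R (u : cc_obj (T M) 1) (v : cc_obj (T' M) 1) := exists b b',
  [/\ ct_map (coind_unit M) u = cc_diff (T (coind M)) 0 b,
      ct_map (coind_unit M) v = cc_diff (T' (coind M)) 0 b' &
      ct_pt (ct_map (cosyzygy_proj M) b) = ct_pt (ct_map (cosyzygy_proj M) b')].
have tot (S S' : cohomology_theory) u (b : cc_obj (S (coind M)) 0) :
    ct_map (coind_unit M) u = cc_diff _ 0 b ->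
    exists v (b' : cc_obj (S' (coind M)) 0),
    [/\ cc_diff (S' M) 1 v = 0, ct_map (coind_unit M) v = cc_diff _ 0 b' &
      ct_pt (ct_map (cosyzygy_proj M) b) = ct_pt (ct_map (cosyzygy_proj M) b')].
  move=> ub; have [c' dc' cb] :=
    ct_pt_surj S' (ct_pt_central (connecting_cocycle ub)).
  have [b' [v [bc dv vb]]] := connecting_surj dc'.
  by exists v, b'; split=> //; rewrite bc.
apply: (cohomology_iso_rel (R := R)).
- move=> c u v u' v' [b [b' [e1 e2 e3]]] [d [d' [e1' e2' e3']]].
  exists (c *: b + d), (c *: b' + d').
  by rewrite !ct_mapP !linearP e1 e1' e2 e2' !ct_ptP e3 e3'.
- move=> u du; have [b ub] := connecting_ex du.
  by have [v [b' [dv vb e]]] := tot T T' u b ub; exists v => //; exists b, b'.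
- move=> v dv; have [b' vb] := connecting_ex dv.
  by have [u [b [du ub e]]] := tot T' T v b' vb; exists u => //; exists b, b'.
- move=> u v du dv [b [b' [ub vb e]]].
  by split; [exact: theory_iso1_half ub vb e
            | exact: (theory_iso1_half vb ub (esym e))].
Qed.

Lemma theory_shift (T : cohomology_theory) M n :
  lin_isomorphic (cohomology (T M) n.+2) (cohomology (T (cosyzygy M)) n.+1).
Proof.
apply: (cohomology_iso_rel (R := fun u v => exists b,
  ct_map (coind_unit M) u = cc_diff (T (coind M)) n.+1 b /\
  ct_map (cosyzygy_proj M) b = v)).
- move=> c u v u' v' [b [e1 e2]] [b' [e1' e2']]; exists (c *: b + b').
  by rewrite !ct_mapP linearP e1 e1' e2 e2'.
- move=> u du; have [b ub] := connecting_ex du.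
  by exists (ct_map (cosyzygy_proj M) b); [exact: connecting_cocycle ub | exists b].
- move=> v dv; have [b [u [bv du ub]]] := connecting_surj dv.
  by exists u => //; exists b.
- move=> u v du dv [b [ub bv]]; split=> [[m mu]|[w wv]].
    have [|c cb] := ct_acyclic (c := T) (u := b - ct_map (coind_unit M) m).
      by rewrite linearB -ub ct_map_diff mu subrr.
    exists (ct_map (cosyzygy_proj M) c).
    by rewrite ct_map_diff cb ct_mapB ct_map_unit_proj subr0.
  have [c cw] := ct_map_surj (c := T) w.
  apply: connecting_coboundary ub _ (cc_diff2 c).
  by rewrite bv -ct_map_diff cw.
Qed.

(** Dimension shifting reduces the degree n + 1 for M to the degree 1 for its n-th
    cosyzygy. *)
Lemma theory_unique (T T' : cohomology_theory) n M :
  lin_isomorphic (cohomology (T M) n) (cohomology (T' M) n).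
Proof.
case: n => [|n]; first exact: theory_iso0.
elim: n M => [|n IH] M; first exact: theory_iso1.
apply: lin_iso_trans (theory_shift T M n) _.
exact: lin_iso_trans (IH _) (lin_iso_sym (theory_shift T' M n)).
Qed.

End Theories.
(** * Ext from a projective resolution of the diagonal bimodule *)

Lemma bhom_ext (k : fieldType) (A : algType k) (M N : bimodule A)
  (f g : bimod_hom M N) : (forall m, f m = g m) -> f = g.
Proof. by move=> fg; apply/val_inj/funext. Qed.

Definition mk_bhom (k : fieldType) (A : algType k) (M N : bimodule A)
    (f : M -> N) (fh : is_bimod_hom f) : bimod_hom M N :=
  to_submod (S := bimod_homs M N) fh.

Section LeftLift.
Variables (k : fieldType) (A : algType k).
Implicit Types M N P U V W : bimodule A.

Definition left_linear M N (f : M -> N) : Prop :=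
  linear f /\ forall x m, f (lact x m) = lact x (f m).

(** Projectivity of A as a vector space, tested on the surjections of bimodules;
    it makes coinduction preserve these surjections. *)
Definition lifts_linear_maps : Prop :=
  forall U W (g : bimod_hom U W) (f : A -> W),
  surjective_hom g -> linear f ->
  exists2 f' : A -> U, linear f' & forall y, g (f' y) = f y.

Hypothesis A_lifts : lifts_linear_maps.

Fact coind_map_linear U W (g : bimod_hom U W) (f : coind U) :
  linear (fun y => g (cofun f y)).
Proof. by move=> c x y; rewrite cofunP bhomP. Qed.
Fact coind_map_subproof U W (g : bimod_hom U W) :
  is_bimod_hom (fun f => mk_coind (coind_map_linear g f)).
Proof.
split=> [c f h|x f|f x]; apply: cofun_inj => y.
- by rewrite cofunPl !cofunE cofunPl bhomP.
- exact: bhom_lact.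
- by [].
Qed.
Definition coind_map U W (g : bimod_hom U W) : bimod_hom (coind U) (coind W) :=
  mk_bhom (coind_map_subproof g).

Lemma coind_map_surj U W (g : bimod_hom U W) :
  surjective_hom g -> surjective_hom (coind_map g).
Proof.
move=> g_surj f; have [f' f'l gf'] := A_lifts g_surj (coind_linear f).
by exists (mk_coind f'l); apply: cofun_inj => y; exact: gf'.
Qed.

(** A projective bimodule is projective as a left module: left module maps into W
    are the bimodule maps into the bimodule coinduced from W. *)
Lemma left_lift P U W (g : bimod_hom U W) (h : P -> W) :
  projective P -> surjective_hom g -> left_linear h ->
  exists2 h' : P -> U, left_linear h' & forall p, g (h' p) = h p.
Proof.
move=> P_proj g_surj [hl ha].
have hyl p : linear (fun y => h (ract p y)).
  by move=> c x y; rewrite ractPr hl.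
have hh : is_bimod_hom (fun p : P => mk_coind (hyl p)).
  split=> [c p q|x p|p x]; apply: cofun_inj => y.
  - by rewrite cofunPl !cofunE ractPl hl.
  - by rewrite cofun_lact !cofunE -lract ha.
  - by rewrite cofun_ract !cofunE ractM.
have [h' h'P] := P_proj _ _ (coind_map g) (mk_bhom hh) (coind_map_surj g_surj).
exists (fun p => cofun (h' p) 1).
  by split=> [c p q|x p]; [rewrite bhomP cofunPl | rewrite bhom_lact].
move=> p; have := congr1 (fun f => cofun f 1) (h'P p).
by rewrite -[g _]/(cofun (coind_map g (h' p)) 1) => ->; exact: (congr1 h (ract1 p)).
Qed.

Lemma exact_left_lift P U V W (g : bimod_hom U V) (e : bimod_hom V W)
    (r : P -> V) :
  projective P -> (forall v, e v = 0 <-> exists u, g u = v) ->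
  left_linear r -> (forall p, e (r p) = 0) ->
  exists2 t : P -> U, left_linear t & forall p, g (t p) = r p.
Proof.
move=> P_proj ex [rl ra] er.
have eg u : e (g u) = 0 by apply/ex; exists u.
pose g' u : bimod_ker e := to_submod (S := bimod_ker_space e) (eg u).
have g'h : is_bimod_hom g'.
  split=> [c u v|x u|u x]; apply: val_inj.
  - by rewrite [RHS]submod_valP; exact: bhomP.
  - exact: bhom_lact.
  - exact: bhom_ract.
have g'_surj : surjective_hom (mk_bhom g'h).
  by move=> w; have /ex[u uw] := submodP w; exists u; apply: val_inj.
pose r' p : bimod_ker e := to_submod (S := bimod_ker_space e) (er p).
have r'l : left_linear r'.
  split=> [c p q|x p]; apply: val_inj; last exact: ra.
  by rewrite [RHS]submod_valP; exact: rl.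
have [t tl tr] := left_lift P_proj g'_surj r'l.
exists t => // p.
exact: (congr1 (fun w : submod (bimod_ker_space e) => val w) (tr p)).
Qed.

Section Resolution.
Variable P : projective_resolution (diagonal A).

(** A projective resolution of the diagonal bimodule splits as a complex of left
    modules, because A is free of rank one over itself. By induction, a retraction
    r of one term onto the kernel of its differential d lifts to a map t along the
    next differential d', and then 1 - t d' retracts the next term onto the kernel
    of d'. *)
Lemma resolution_left_split n : exists2 t : res_obj P n -> res_obj P n.+1,
  left_linear t &
  forall p, res_diff P n (t (res_diff P n p)) = res_diff P n p.
Proof.
elim: n => [|n [t [tl ta] tP]].
  (* x |-> x p0 is a left linear section of the augmentation. *)
  have [p0 p0P] := res_aug_surj P (1 : A).
  pose r (p : res_obj P 0) := p - lact (res_aug P p : A) p0.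
  have [|||p|t tl tr] := @exact_left_lift (res_obj P 0) _ _ _
    (res_diff P 0) (res_aug P) r.
  - exact: res_projective.
  - exact: res_aug_exact.
  - split=> [c p q|x p]; rewrite /r.
      by rewrite bhomP lactPl opprD addrACA scalerBr.
    rewrite bhom_lact lactDr lactNr -lactM; congr (_ - _).
  - rewrite /r bhomD bhomN bhom_lact p0P.
    by rewrite [lact _ _]mulr1 subrr.
  exists t => // p; rewrite tr /r.
  have -> : res_aug P (res_diff P 0 p) = 0 by apply/res_aug_exact; exists p.
  by rewrite lact0l subr0.
pose r p := p - t (res_diff P n p).
have [|||p|s sl sr] := @exact_left_lift (res_obj P n.+1) _ _ _
  (res_diff P n.+1) (res_diff P n) r.
- exact: res_projective.
- exact: res_exact.
- split=> [c p q|x p]; rewrite /r.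
    by rewrite bhomP tl opprD addrACA scalerBr.
  by rewrite bhom_lact ta lactDr lactNr.
- by rewrite /r bhomD bhomN tP subrr.
exists s => // p; rewrite sr /r.
have -> : res_diff P n (res_diff P n.+1 p) = 0 by apply/res_exact; exists p.
have t0 : t 0 = 0.
  by have := ta 0 0; rewrite !lact0l.
by rewrite t0 subr0.
Qed.

(** A cocycle u is, as a left module map into M, the composite of u t with the
    differential, where t splits the resolution. *)
Lemma ext_coind_acyclic M n (u : bimod_hom (res_obj P n.+1) (coind M)) :
  ext_diff u = 0 -> exists v, @ext_diff _ _ _ P (coind M) n v = u.
Proof.
move=> du; have [t [tl ta] tP] := resolution_left_split n.
have ud q : u (res_diff P n.+1 q) = 0.
  exact: (congr1 (fun f : bimod_hom _ (coind M) => f q) du).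
have vl p : linear (fun y => cofun (u (t (ract p y))) 1).
  by move=> c x y; rewrite ractPr tl bhomP cofunPl.
have vh : is_bimod_hom (fun p => mk_coind (vl p)).
  split=> [c p q|x p|p x]; apply: cofun_inj => y.
  - by rewrite cofunPl !cofunE ractPl tl bhomP cofunPl.
  - by rewrite cofun_lact !cofunE -lract ta bhom_lact.
  - by rewrite cofun_ract !cofunE ractM.
exists (mk_bhom vh); apply: bhom_ext => p; apply: cofun_inj => y.
change (cofun (u (t (ract (res_diff P n p) y))) 1 = cofun (u p) y).
rewrite -bhom_ract; set q := ract p y.
have [q' q'P] : exists q', res_diff P n.+1 q' = t (res_diff P n q) - q.
  by apply/res_exact; rewrite bhomD bhomN tP subrr.
rewrite -[t _](subrK q) -q'P bhomD ud add0r /q bhom_ract cofun_ract.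
by rewrite mulr1.
Qed.

Lemma ext_unit_exact M n (u : bimod_hom (res_obj P n) (coind M)) :
  bimod_comp (cosyzygy_proj M) u = 0 ->
  exists v, bimod_comp (coind_unit M) v = u.
Proof.
move=> u0.
have ex p : exists m, coind_unit M m = u p.
  apply/coker_proj0.
  exact: (congr1 (fun f : bimod_hom _ (cosyzygy M) => f p) u0).
have [v vP] := choice ex.
have vh : is_bimod_hom v.
  split=> [c p q|x p|p x]; apply: (@coind_unit_inj _ _ M); rewrite vP.
  - by rewrite !bhomP !vP.
  - by rewrite !bhom_lact vP.
  - by rewrite !bhom_ract vP.
by exists (mk_bhom vh); apply: bhom_ext => p; exact: vP.
Qed.

Definition unit_lift : res_obj P 0 := sval (cid (res_aug_surj P (1 : A))).

Lemma unit_liftP : res_aug P unit_lift = (1 : A).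
Proof. exact: (svalP (cid (res_aug_surj P (1 : A)))). Qed.

(** A cocycle of degree 0 factors through the augmentation, and A is generated
    by 1. *)
Lemma ext_cocycle0 M (u : bimod_hom (res_obj P 0) M) : ext_diff u = 0 ->
  forall p, u p = lact (res_aug P p : A) (u unit_lift).
Proof.
move=> du p.
have ud q : u (res_diff P 0 q) = 0.
  exact: (congr1 (fun f : bimod_hom _ M => f q) du).
have [q qP] : exists q, res_diff P 0 q = p - lact (res_aug P p : A) unit_lift.
  apply/res_aug_exact; rewrite bhomD bhomN bhom_lact unit_liftP.
  by rewrite [lact _ _]mulr1 subrr.
rewrite -[in LHS](subrK (lact (res_aug P p : A) unit_lift) p) -qP.
by rewrite bhomD ud add0r bhom_lact.
Qed.

Lemma ext_cocycle0_central M (u : bimod_hom (res_obj P 0) M) :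
  ext_diff u = 0 -> central (u unit_lift).
Proof.
move=> du x; rewrite -bhom_ract (ext_cocycle0 du (ract _ _)) bhom_ract unit_liftP.
by congr (lact _ _); rewrite [RHS]mul1r.
Qed.

Lemma ext_cocycle0_surj M (m : M) : central m ->
  exists2 u : bimod_hom (res_obj P 0) M, ext_diff u = 0 & u unit_lift = m.
Proof.
move=> mc; have uh : is_bimod_hom (fun p => lact (res_aug P p : A) m).
  split=> [c p q|x p|p x].
  - by rewrite bhomP lactPl.
  - by rewrite bhom_lact -lactM.
  - by rewrite bhom_ract [ract _ _]/(res_aug P p * x) lactM mc lract.
exists (mk_bhom uh); last first.
  by change (lact (res_aug P unit_lift : A) m = m); rewrite unit_liftP lact1.
apply: bhom_ext => p; change (lact (res_aug P (res_diff P 0 p) : A) m = 0).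
have -> : res_aug P (res_diff P 0 p) = 0 by apply/res_aug_exact; exists p.
exact: lact0l.
Qed.

Definition ext_theory : cohomology_theory A.
Proof.
refine (@CohomologyTheory k A (ext_complex P)
  (fun M N f n => @bimod_comp _ _ (res_obj P n) M N f)
  _ _ _ (@ext_unit_exact) _ _ (@ext_coind_acyclic)
  (fun M (u : bimod_hom (res_obj P 0) M) => u unit_lift) _ _
  (@ext_cocycle0_central) (@ext_cocycle0_surj) _).
- by move=> M N f n c u v; apply: bhom_ext => p; exact: bhomP.
- by move=> M N f n u; exact: bhom_ext.
- move=> M N f n f_inj u v uv; apply: bhom_ext => p; apply: f_inj.
  exact: (congr1 (fun g : bimod_hom _ N => g p) uv).
- move=> M n u; apply: bhom_ext => p.
  by apply/(coker_proj0 (coind_unit M)); exists (bimod_hom_fun u p).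
- move=> M n v.
  have [u uP] := res_projective v (@coker_proj_surj _ _ _ _ (coind_unit M)).
  by exists u; apply: bhom_ext.
- by [].
- by [].
- move=> M u du u0; apply: bhom_ext => p.
  by rewrite (ext_cocycle0 du) u0 lact0r.
Defined.

End Resolution.
End LeftLift.
(** * Pre-natural transformations *)

Section PreNatTheory.
Variables (k : fieldType) (N : nat).
Notation A := (Calg k N).
Implicit Types M L : bimodule A.

Definition mk_prenat M d (f : obj N -> chain k N -> M) (fP : is_prenat d f) :
  prenat M d := to_submod (S := prenat_space M d) fP.

Definition prenat_fun M d (f : prenat M d) : obj N -> chain k N -> M := val f.

Lemma prenat_is M d (f : prenat M d) : is_prenat d (prenat_fun f).
Proof. exact: (submodP (f : submod (prenat_space M d))). Qed.

Lemma prenat_ext M d (f g : prenat M d) :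
  (forall x s, prenat_fun f x s = prenat_fun g x s) -> f = g.
Proof.
by move=> fg; apply: val_inj; apply/funext => x; apply/funext => s; exact: fg.
Qed.

Lemma prenat_funP M d c (f g : prenat M d) x s :
  prenat_fun (c *: f + g) x s = c *: prenat_fun f x s + prenat_fun g x s.
Proof.
exact: (congr1 (fun h : obj N -> chain k N -> M => h x s) (submod_valP c f g)).
Qed.

Lemma prenat_diff_funE M d (f : prenat M d) x y a s :
  prenat_fun (prenat_diff f) x ((y, a) :: s) =
  ract (prenat_fun f y s) (emb x y a) + pd_rec (prenat_fun f x) x ((y, a) :: s).
Proof. exact: prenat_diff_cons. Qed.

Lemma prenat_diff_nil M d (f : prenat M d) x :
  prenat_fun (prenat_diff f) x [::] = 0.
Proof. by []. Qed.

Lemma left_linear0 M L (f : M -> L) : left_linear f -> f 0 = 0.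
Proof. by move=> [_ fa]; have := fa 0 0; rewrite !lact0l. Qed.

Lemma left_linearN M L (f : M -> L) m : left_linear f -> f (- m) = - f m.
Proof.
move=> fl; have := fl.1 (-1) m 0.
by rewrite (left_linear0 fl) !addr0 !scaleN1r.
Qed.

Lemma left_linearD M L (f : M -> L) m n : left_linear f -> f (m + n) = f m + f n.
Proof. by move=> fl; have := fl.1 1 m n; rewrite !scale1r. Qed.

Lemma bhom_left_linear M L (f : bimod_hom M L) : left_linear f.
Proof. by split=> [c m n|x m]; [exact: bhomP | exact: bhom_lact]. Qed.

Lemma cofun_left_linear M (y : A) : left_linear (fun f : coind M => cofun f y).
Proof. by split=> [c f g|x f]; [exact: cofunPl | exact: cofun_lact]. Qed.

(** All terms of the differential but the one with the right action only use the
    left module structure. *)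
Lemma pd_rec_left_linear M L (phi : M -> L) (F : chain k N -> M) x s :
  left_linear phi ->
  phi (pd_rec F x s) = pd_rec (fun t => phi (F t)) x s.
Proof.
move=> phil; elim: s F x => [|[y a] s IH] F x /=; first exact: left_linear0.
rewrite (left_linearD _ _ phil) !(left_linearN _ phil) IH.
by congr (- _ - _); case: s {IH} => [|[z b] s] //; rewrite (phil.2).
Qed.

Lemma pd_rec_sum M (I : finType) (F : I -> chain k N -> M) x s :
  pd_rec (fun t => \sum_z F z t) x s = \sum_z pd_rec (F z) x s.
Proof.
elim: (index_enum I) => [|z r IH].
  rewrite big_nil -[RHS](pd_rec0 M x s); apply: pd_rec_ext => t _.
  by rewrite big_nil.
rewrite big_cons -IH -[pd_rec (F z) x s]scale1r -pd_recP.
by apply: pd_rec_ext => t _; rewrite big_cons scale1r.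
Qed.

Fact prenat_map_subproof M L (f : bimod_hom M L) d (g : prenat M d) :
  is_prenat d (fun x s => f (prenat_fun g x s)).
Proof.
have [g1 g2 g3] := prenat_is g; split=> *.
- by rewrite g1 ?bhom0.
- by rewrite -bhom_ract -bhom_lact g2.
- by rewrite g3 bhomP.
Qed.
Definition prenat_map M L (f : bimod_hom M L) d (g : prenat M d) : prenat L d :=
  mk_prenat (prenat_map_subproof f g).

Lemma prenat_map_diff M L (f : bimod_hom M L) d (g : prenat M d) :
  prenat_diff (prenat_map f g) = prenat_map f (prenat_diff g).
Proof.
apply: prenat_ext => x [|[y a] s].
  by rewrite prenat_diff_nil; exact/esym/bhom0.
rewrite prenat_diff_funE -[RHS]/(f (prenat_fun (prenat_diff g) x _)).
rewrite prenat_diff_funE bhomD bhom_ract.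
by rewrite (pd_rec_left_linear _ _ _ (bhom_left_linear f)).
Qed.

Lemma prenat_unit_exact M d (u : prenat (coind M) d) :
  prenat_map (cosyzygy_proj M) u = 0 ->
  exists v, prenat_map (coind_unit M) v = u.
Proof.
move=> u0.
have ex x s : exists m, coind_unit M m = prenat_fun u x s.
  apply/coker_proj0.
  exact: (congr1 (fun f : prenat (cosyzygy M) d => prenat_fun f x s) u0).
have [v' v'P] := choice (fun p : obj N * chain k N => ex p.1 p.2).
pose v x s := v' (x, s).
have vP x s : coind_unit M (v x s) = prenat_fun u x s := v'P (x, s).
have [u1 u2 u3] := prenat_is u.
have vh : is_prenat d v.
  split=> *; apply: (@coind_unit_inj _ _ M).
  - by rewrite vP u1 // bhom0.
  - by rewrite bhom_lact bhom_ract vP u2.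
  - by rewrite bhomP !vP u3.
by exists (mk_prenat vh); apply: prenat_ext => x s; exact: vP.
Qed.

(** Applying a linear section of the quotient map to the values keeps them
    multilinear. *)
Lemma prenat_proj_surj M d (v : prenat (cosyzygy M) d) :
  exists u, prenat_map (cosyzygy_proj M) u = v.
Proof.
have [v1 v2 v3] := prenat_is v; have [t [tl tP]] := cosyzygy_section M.
have t0 : t 0 = 0.
  by have := tl (-1) 0 0; rewrite !scaleN1r oppr0 addr0 addNr.
(* The section ignores the action of A, so the idempotents are put back. *)
pose u x s := lact (idem k (target x s)) (ract (t (prenat_fun v x s)) (idem k x)).
have idemK x : idem k x * idem k x = idem k x by exact: emb_idemr.
have uh : is_prenat d u.
  rewrite /u; split=> [x s sd|x s|x s y c a b r].
  - by rewrite v1 // t0 ract0l lact0r.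
  - by rewrite -[ract (lact _ _) _]lract -lactM -ractM !idemK.
  - rewrite v3 tl ractPl lactPr.
    by rewrite (target_cat x s y (c *: a + b) a r) (target_cat x s y b a r).
exists (mk_prenat uh); apply: prenat_ext => x s.
by rewrite -[LHS]/(cosyzygy_proj M (u x s)) /u bhom_lact bhom_ract tP v2.
Qed.

Lemma Calg_sum_emb (y : A) : y = \sum_x \sum_z emb z x (y (z, x)).
Proof.
apply/ffunP => -[z x]; rewrite !sum_ffunE (bigD1 x) //= sum_ffunE (bigD1 z) //=.
rewrite ffunE eqxx !big1 ?addr0 // => [x' xx'|z' zz'].
  rewrite sum_ffunE big1 // => z' _; rewrite ffunE xpair_eqE [x == _]eq_sym.
  by rewrite (negbTE xx') andbF.
by rewrite ffunE xpair_eqE [z == _]eq_sym (negbTE zz').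
Qed.

Lemma idem_mul_sum x (y : A) : idem k x * y = \sum_z emb z x (y (z, x)).
Proof.
rewrite [in LHS](Calg_sum_emb y) mulr_sumr.
rewrite (bigD1 x) //= [X in _ + X]big1 => [|x' xx'].
  rewrite addr0 mulr_sumr; apply: eq_bigr => z _; exact: emb_ideml.
by rewrite mulr_sumr big1 // => z _; exact: emb_mul0.
Qed.

(** The contraction h of the bar complex: h f at a chain and at y in A is the value
    of f at the chain preceded by the arrow y, evaluated at 1. A general y has to
    be split into its components first, whence the sum over the source z. *)
Lemma prenat_coind_acyclic M d (f : prenat (coind M) d.+1) :
  prenat_diff f = 0 -> exists g, @prenat_diff _ _ (coind M) d g = f.
Proof.
move=> df; have [f1 f2 f3] := prenat_is f; set F := prenat_fun f in f1 f2 f3.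
pose h x s (y : A) := \sum_z cofun (F z ((x, y (z, x)) :: s)) 1.
have hl x s : linear (h x s).
  move=> c y y'; rewrite /h scaler_sumr -big_split; apply: eq_bigr => z _ /=.
  by rewrite !ffunE (f3 z [::]) cofunPl.
have F1 z s (y : A) : cofun (F z s) (idem k z * y) = cofun (F z s) y.
  by rewrite -cofun_ract -(f2 z s) -lract -ractM emb_idemr.
have hP : is_prenat d (fun x s => mk_coind (hl x s)).
  split=> [x s sd|x s|x s y c a b t]; apply: cofun_inj => w.
  - rewrite cofunE cofun0 /h big1 // => z _.
    by rewrite f1 //= eqSS.
  - rewrite cofun_lact cofun_ract !cofunE /h.
    rewrite -[LHS]/(lact _ (\sum_z _)).
    have -> : \sum_z cofun (F z ((x, (idem k x * w) (z, x)) :: s)) 1 =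
              \sum_z cofun (F z ((x, w (z, x)) :: s)) 1.
      apply: eq_bigr => z _; congr (cofun (F z ((x, _) :: s)) 1).
      rewrite idem_mul_sum sum_ffunE (bigD1 z) //= ffunE eqxx big1 ?addr0 //.
      by move=> z' zz'; rewrite ffunE xpair_eqE [z == _]eq_sym (negbTE zz').
    rewrite (big_morph _ (lactDr _) (lact0r _ _)); apply: eq_bigr => z _.
    rewrite -[in RHS](f2 z) cofun_lact cofun_ract.
    by congr (lact _ _); rewrite F1.
  - rewrite cofunPl !cofunE /h scaler_sumr -big_split; apply: eq_bigr => z _ /=.
    by rewrite (f3 z ((x, w (z, x)) :: s)) cofunPl.
exists (mk_prenat hP); apply: prenat_ext => x [|[w a] s].
  by rewrite prenat_diff_nil -/F f1.
rewrite prenat_diff_funE; apply: cofun_inj => y.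
rewrite (left_linearD _ _ (cofun_left_linear M y)).
rewrite (pd_rec_left_linear _ _ _ (cofun_left_linear M y)).
rewrite -/F -[in RHS]F1 idem_mul_sum.
have -> : cofun (F x ((w, a) :: s)) (\sum_z emb z x (y (z, x))) =
   \sum_z cofun (F x ((w, a) :: s)) (emb z x (y (z, x))).
  apply: (big_morph _ (id1 := 0)) => [u v|].
    by have := cofunP (F x ((w, a) :: s)) 1 u v; rewrite !scale1r.
  exact: cofun_0r.
have E z : cofun (F x ((w, a) :: s)) (emb z x (y (z, x))) =
    cofun (F z ((w, comp z x w a (y (z, x))) :: s)) 1 +
    pd_rec (fun t => cofun (F z ((x, y (z, x)) :: t)) 1) x ((w, a) :: s).
  have := congr1 (fun g : prenat (coind M) d.+2 =>
    cofun (prenat_fun g z [:: (x, y (z, x)), (w, a) & s]) 1) df.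
  rewrite prenat_diff_funE pd_rec_cons2 -/F => /eqP.
  rewrite -opprD (left_linearD _ _ (cofun_left_linear M 1)).
  rewrite (left_linearN _ (cofun_left_linear M 1)).
  rewrite (left_linearD _ _ (cofun_left_linear M 1)).
  rewrite (pd_rec_left_linear _ _ _ (cofun_left_linear M 1)).
  by rewrite cofun_ract mulr1 subr_eq0 => /eqP.
rewrite (eq_bigr _ (fun z _ => E z)) big_split -[RHS]/(_ + _).
congr (_ + _); last first.
  exact: (pd_rec_sum (fun z t => cofun (F z ((x, y (z, x)) :: t)) 1)).
rewrite cofun_ract -[LHS]/(h w s (emb x w a * y)) /h; apply: eq_bigr => z _.
congr (cofun (F z ((w, _) :: s)) 1); rewrite ffunE (bigD1 x) //= ffunE eqxx.
rewrite big1 ?addr0 // => x' xx'.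
by rewrite ffunE xpair_eqE (negbTE xx') /= /comp mul0r mulr0.
Qed.

Definition prenat_pt M (f : prenat M 0) : M := \sum_x prenat_fun f x [::].

Lemma prenat0_cocycle M (f : prenat M 0) : prenat_diff f = 0 ->
  forall x y a, ract (prenat_fun f y [::]) (emb x y a) =
                lact (emb x y a) (prenat_fun f x [::]).
Proof.
move=> df x y a; apply/eqP; rewrite -subr_eq0.
have := congr1 (fun g : prenat M 1 => prenat_fun g x [:: (y, a)]) df.
by rewrite prenat_diff_funE /= subr0 => /eqP.
Qed.

Lemma prenat0_typed M (f : prenat M 0) x :
  lact (idem k x) (ract (prenat_fun f x [::]) (idem k x)) = prenat_fun f x [::].
Proof. by have [_ f2 _] := prenat_is f; exact: (f2 x [::]). Qed.

Lemma idem_mulr0 (x y : obj N) : x != y -> idem k x * idem k y = 0.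
Proof. by move=> xy; rewrite emb_mul0 // eq_sym. Qed.

Lemma central_sum M (m : obj N -> M) :
  (forall x, lact (idem k x) (ract (m x) (idem k x)) = m x) ->
  (forall x y a, ract (m y) (emb x y a) = lact (emb x y a) (m x)) ->
  central (\sum_x m x).
Proof.
move=> mt mc y; rewrite (Calg_sum_emb y).
have lactZ x z (a : {poly k}) x' : x' != z ->  lact (emb z x a) (m x') = 0.
  by move=> xz; rewrite -(mt x') -lactM emb_mul0 // lact0l.
have ractZ x z (a : {poly k}) x' : x' != x ->  ract (m x') (emb z x a) = 0.
  by move=> xz; rewrite -(mt x') -lract -ractM emb_mul0 1?eq_sym // ract0r lact0r.
rewrite (big_morph (fun u => lact u _) (fun u v => lactDl u v _) (lact0l _)).
rewrite (big_morph (fun u => ract _ u) (fun u v => ractDr _ u v) (ract0r _)).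
apply: eq_bigr => x _.
rewrite (big_morph (fun u => lact u _) (fun u v => lactDl u v _) (lact0l _)).
rewrite (big_morph (fun u => ract _ u) (fun u v => ractDr _ u v) (ract0r _)).
apply: eq_bigr => z _.
rewrite (big_morph _ (lactDr _) (lact0r _ _)) (big_morph _ (ractDl _) (ract0l _ _)).
rewrite (bigD1 z) // big1 => [|x' x'z]; last exact: lactZ.
rewrite [RHS](bigD1 x) // big1 => [|x' x'x]; last exact: ractZ.
by rewrite /= !addr0 mc.
Qed.

Lemma central_typed M (m : M) x : central m ->
  lact (idem k x) (ract (lact (idem k x) m) (idem k x)) = lact (idem k x) m.
Proof. by move=> mc; rewrite -lract -mc -!lactM !emb_idemr. Qed.

Lemma central_emb M (m : M) x y a : central m ->
  ract (lact (idem k y) m) (emb x y a) = lact (emb x y a) (lact (idem k x) m).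
Proof. by move=> mc; rewrite -lract -mc -!lactM emb_ideml emb_idemr. Qed.

Lemma sum_idem : \sum_(x : obj N) idem k x = 1 :> A.
Proof. by []. Qed.

Lemma central_sum_idem M (m : M) : \sum_(x : obj N) lact (idem k x) m = m.
Proof.
rewrite -(big_morph (fun u => lact u m) (fun u v => lactDl u v m) (lact0l _)).
by rewrite sum_idem lact1.
Qed.

Lemma typed_sum0 M (m : obj N -> M) :
  (forall x, lact (idem k x) (ract (m x) (idem k x)) = m x) ->
  \sum_x m x = 0 -> forall x, m x = 0.
Proof.
move=> mt m0 x; rewrite -(mt x).
have := congr1 (fun u => lact (idem k x) (ract u (idem k x))) m0 => /=.
rewrite ract0l lact0r (big_morph _ (ractDl _) (ract0l _ _)).
rewrite (big_morph _ (lactDr _) (lact0r _ _)) (bigD1 x) // big1 => [|y yx].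
  by rewrite /= addr0.
by rewrite -(mt y) -!lract -ractM idem_mulr0 // !ract0r !lact0r.
Qed.

Definition prenat_theory : cohomology_theory A.
Proof.
refine (@CohomologyTheory k A (fun M => prenat_complex M)
  prenat_map _ _ _ prenat_unit_exact _ prenat_proj_surj prenat_coind_acyclic
  prenat_pt _ _ _ _ _).
- move=> M L f n c u v; apply: prenat_ext => x s; rewrite prenat_funP.
  by rewrite -[LHS]/(f (prenat_fun (c *: u + v) x s)) prenat_funP bhomP.
- exact: prenat_map_diff.
- move=> M L f n f_inj u v uv; apply: prenat_ext => x s; apply: f_inj.
  exact: (congr1 (fun g : prenat L n => prenat_fun g x s) uv).
- move=> M n u; apply: prenat_ext => x s.
  by apply/(coker_proj0 (coind_unit M)); exists (prenat_fun u x s).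
- move=> M c u v; rewrite /prenat_pt scaler_sumr -big_split.
  by apply: eq_bigr => x _; rewrite prenat_funP.
- move=> M L f u; rewrite /prenat_pt.
  by rewrite [RHS](big_morph _ (bhomD f) (bhom0 f)).
- move=> M u du; apply: central_sum; first exact: prenat0_typed.
  exact: prenat0_cocycle.
- move=> M m mc.
  pose u x (s : chain k N) := if s is [::] then lact (idem k x) m else 0.
  have uP : is_prenat 0 u.
    split=> [x [|p s] //|x [|p s]|x s y c a b t].
    + exact: central_typed.
    + by rewrite /= ract0l lact0r.
    + by case: s => [|p s]; rewrite /= scaler0 addr0.
  exists (mk_prenat uP); last exact: central_sum_idem.
  apply: prenat_ext => x [|[y a] [|p s]]; first by [].
    rewrite [prenat_fun _ _ _]prenat_diff_funE /= subr0.
    by rewrite -[RHS](subrr (lact (emb x y a) (lact (idem k x) m))) -central_emb.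
  have [v1 _ _] := prenat_is (prenat_diff (mk_prenat uP)).
  exact: v1.
- move=> M u du u0.
  have ux := typed_sum0 (prenat0_typed u) u0.
  have [u1 _ _] := prenat_is u.
  by apply: prenat_ext => x [|p s]; [exact: ux | exact: u1].
Defined.

End PreNatTheory.
(** * Linear maps out of the algebra *)

Section PolyLinear.
Variables (k : fieldType) (V : lmodType k).

Definition poly_ext (G : nat -> V) (p : {poly k}) : V :=
  \sum_(b < size p) p`_b *: G b.

Lemma poly_ext_widen G (p : {poly k}) n : (size p <= n)%N ->
  poly_ext G p = \sum_(b < n) p`_b *: G b.
Proof.
move=> pn; rewrite /poly_ext (big_ord_widen n (fun b => p`_b *: G b)) //.
rewrite big_mkcond; apply: eq_bigr => b _; case: ltnP => // bp.
by rewrite nth_default // scale0r.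
Qed.

Lemma poly_ext_linear G : linear (poly_ext G).
Proof.
move=> c p q; pose n := maxn (size p) (size q).
rewrite !(@poly_ext_widen G _ n) ?leq_maxl ?leq_maxr //; last first.
  apply: leq_trans (size_polyD _ _) _; rewrite geq_max leq_maxr andbT.
  exact: leq_trans (size_scale_leq _ _) (leq_maxl _ _).
rewrite scaler_sumr -big_split; apply: eq_bigr => b _ /=.
by rewrite coefD coefZ scalerDl scalerA.
Qed.

Lemma poly_extXn G b : poly_ext G 'X^b = G b.
Proof.
rewrite /poly_ext size_polyXn big_ord_recr /= coefXn eqxx scale1r big1 ?add0r //.
by move=> c _; rewrite coefXn ltn_eqF // scale0r.
Qed.

Lemma linear_polyE (f : {poly k} -> V) : linear f ->
  forall p, f p = poly_ext (fun b => f 'X^b) p.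
Proof.
move=> fl p; rewrite -[in LHS](coefK p) poly_def.
have f0 : f 0 = 0.
  by have := fl (-1) 0 0; rewrite !scaleN1r oppr0 addr0 addNr.
rewrite (big_morph f (id1 := 0) (op1 := +%R)) // => [|u v].
  by apply: eq_bigr => b _; have := fl p`_b 'X^b 0; rewrite f0 !addr0.
by have := fl 1 u v; rewrite !scale1r.
Qed.
End PolyLinear.

Section CalgLinear.
Variables (k : fieldType) (N : nat).
Notation A := (Calg k N).
Implicit Types (V : lmodType k).

Lemma Calg_linear_ext V (G : obj N -> obj N -> nat -> V) :
  exists2 f : A -> V, linear f & forall i t b, f (emb i t 'X^b) = G i t b.
Proof.
exists (fun y => \sum_p poly_ext (G p.1 p.2) (y p)).
  move=> c x y; rewrite scaler_sumr -big_split; apply: eq_bigr => p _ /=.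
  by rewrite !ffunE poly_ext_linear.
move=> i t b; rewrite (bigD1 (i, t)) //= big1 => [|p pit].
  by rewrite ffunE eqxx poly_extXn addr0.
by rewrite ffunE (negbTE pit) /poly_ext size_poly0 big_ord0.
Qed.

Lemma Calg_linear_eq V (f g : A -> V) : linear f -> linear g ->
  (forall i t b, f (emb i t 'X^b) = g (emb i t 'X^b)) -> forall y, f y = g y.
Proof.
move=> fl gl fg y.
have lin0 (h : A -> V) : linear h -> h 0 = 0.
  by move=> hl; have := hl (-1) 0 0; rewrite !scaleN1r oppr0 addr0 addNr.
have linD (h : A -> V) : linear h -> {morph h : u v / u + v}.
  by move=> hl u v; have := hl 1 u v; rewrite !scale1r.
rewrite (Calg_sum_emb y) !(big_morph _ (linD _ fl) (lin0 _ fl)).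
rewrite !(big_morph _ (linD _ gl) (lin0 _ gl)); apply: eq_bigr => x _.
rewrite !(big_morph _ (linD _ fl) (lin0 _ fl)).
rewrite !(big_morph _ (linD _ gl) (lin0 _ gl)); apply: eq_bigr => z _.
have embl (h : A -> V) : linear h -> linear (h \o emb z x).
  by move=> hl c p q; rewrite /= emb_linear hl.
rewrite -[LHS]/((f \o emb z x) _) -[RHS]/((g \o emb z x) _).
rewrite (linear_polyE (embl _ fl)) (linear_polyE (embl _ gl)).
by apply: eq_bigr => b _; congr (_ *: _); exact: fg.
Qed.

Lemma Calg_lifts_linear_maps : lifts_linear_maps A.
Proof.
move=> U W g f g_surj fl.
have [G GP] := choice (fun p : obj N * obj N * nat =>
  g_surj (f (emb p.1.1 p.1.2 'X^(p.2)))).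
have [f' f'l f'P] := Calg_linear_ext (fun i t b => G (i, t, b)).
exists f' => //.
apply: (@Calg_linear_eq W (fun y => g (f' y)) f) => // [c x y|i t b].
  by rewrite f'l bhomP.
by rewrite f'P GP.
Qed.

End CalgLinear.

(** * The Koszul complex *)

Section Koszul.
Variables (k : fieldType) (N : nat).
Notation A := (Calg k N).
Implicit Types (M L : bimodule A) (x y s t : obj N).

Definition adj (s t : nat) : bool := (s == t.+1) || (t == s.+1).

(** The cells of degree 0, 1 and 2 are the vertices, the arrows and the relations
    of the quiver with two arrows s -> s + 1 and s + 1 -> s for each s < N; the
    relation at j equates the loops at j through j + 1 and j - 1. Indexing all of
    them by pairs of objects, the source and the target, treats the functoriality
    of the complex in all degrees at once. *)
Definition cell (n : nat) x y : bool :=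
  match n with
  | 0 => x == y
  | 1 => adj x y
  | 2 => [&& x == y, 0 < x & x < N]%N
  | _ => false
  end.

Definition is_koszul M n (f : obj N -> obj N -> M) : Prop :=
  forall x y, (if cell n x y then lact (idem k y) (ract (f x y) (idem k x)) else 0)
    = f x y.

Fact koszul0 M n : is_koszul n (0 : obj N -> obj N -> M).
Proof.
move=> x y; rewrite -[(0 : obj N -> obj N -> M) x y]/(0 : M).
by case: ifP => // _; rewrite ract0l lact0r.
Qed.
Fact koszulP M n (c : k) (f g : obj N -> obj N -> M) :
  is_koszul n f -> is_koszul n g -> is_koszul n (c *: f + g).
Proof.
move=> fP gP x y; rewrite -[(c *: f + g) x y]/(c *: f x y + g x y).
rewrite -[in RHS](fP x y) -[in RHS](gP x y); case: ifP => _.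
  by rewrite ractPl lactPr.
by rewrite scaler0 addr0.
Qed.
Definition koszul_space M n : subspace (obj N -> obj N -> M) :=
  @Subspace k _ (@is_koszul M n) (@koszul0 M n) (@koszulP M n).
Definition koszul M n : lmodType k := submod (koszul_space M n).

Definition kfun M n (f : koszul M n) : obj N -> obj N -> M :=
  val (f : submod (koszul_space M n)).
Definition mk_koszul M n (f : obj N -> obj N -> M) (fP : is_koszul n f) :
  koszul M n := to_submod (S := koszul_space M n) fP.

Lemma kfun_is M n (f : koszul M n) : is_koszul n (kfun f).
Proof. exact: (submodP (f : submod (koszul_space M n))). Qed.

Lemma koszul_ext M n (f g : koszul M n) :
  (forall x y, kfun f x y = kfun g x y) -> f = g.
Proof.
by move=> fg; apply: val_inj; apply/funext => x; apply/funext => y; exact: fg.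
Qed.

Lemma kfunP M n c (f g : koszul M n) x y :
  kfun (c *: f + g) x y = c *: kfun f x y + kfun g x y.
Proof.
exact: (congr1 (fun h : obj N -> obj N -> M => h x y) (submod_valP c f g)).
Qed.

Lemma kfun_typed M n (f : koszul M n) x y :
  lact (idem k y) (ract (kfun f x y) (idem k x)) = kfun f x y.
Proof.
rewrite -(kfun_is f); case: ifP => _; last by rewrite ract0l lact0r.
by rewrite -lract -lactM -ractM !emb_idemr.
Qed.

Lemma kfun_out M n (f : koszul M n) x y : ~~ cell n x y -> kfun f x y = 0.
Proof. by rewrite -(kfun_is f) => /negbTE ->. Qed.

Lemma is_koszulE M n (f : obj N -> obj N -> M) :
  (forall x y, cell n x y -> lact (idem k y) (ract (f x y) (idem k x)) = f x y) ->
  (forall x y, ~~ cell n x y -> f x y = 0) -> is_koszul n f.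
Proof. by move=> f1 f2 x y; case: ifPn => c; [exact: f1 | rewrite f2]. Qed.

Definition arr s t : A := emb s t 1.

(** The derivation with values f on the arrows, at the loop j -> t -> j. *)
Definition loop M (f : obj N -> obj N -> M) (j t : obj N) : M :=
  lact (arr t j) (f j t) + ract (f t j) (arr j t).

Definition kdiff_fun M n (f : obj N -> obj N -> M) x y : M :=
  if cell n.+1 x y then
    match n with
    | 0 => lact (arr x y) (f x x) - ract (f y y) (arr x y)
    | 1 => loop f x (inord x.+1) - loop f x (inord x.-1)
    | _ => 0
    end
  else 0.

Lemma arr_idemr s t : arr s t * idem k s = arr s t.
Proof. exact: emb_idemr. Qed.
Lemma arr_ideml s t : idem k t * arr s t = arr s t.
Proof. exact: emb_ideml. Qed.

Fact kdiff_subproof M n (f : koszul M n) : is_koszul n.+1 (kdiff_fun n (kfun f)).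
Proof.
apply: is_koszulE => x y; rewrite /kdiff_fun; last by move=> /negbTE ->.
move=> c; rewrite c.
have T s t : ract (kfun f s t) (idem k s) = kfun f s t.
  by rewrite -(kfun_typed f s t) -lract -ractM emb_idemr.
have T' s t : lact (idem k t) (kfun f s t) = kfun f s t.
  by rewrite -(kfun_typed f s t) -lactM emb_idemr.
case: n f c T T' => [|[|n]] f c T T' //.
- rewrite ractDl ractNl lactDr lactNr -ractM arr_idemr.
  by rewrite -lract T -lactM arr_ideml lract T'.
- case/andP: c => /eqP <- _; rewrite ractDl ractNl lactDr lactNr /loop.
  have L t : lact (idem k x) (ract (lact (arr t x) (kfun f x t) +
      ract (kfun f t x) (arr x t)) (idem k x)) =
      lact (arr t x) (kfun f x t) + ract (kfun f t x) (arr x t).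
    by rewrite ractDl lactDr -lract T -ractM arr_idemr -lactM arr_ideml lract T'.
  by rewrite !L.
Qed.
Definition kdiff M n (f : koszul M n) : koszul M n.+1 :=
  mk_koszul (kdiff_subproof f).

Lemma kdiffE M n (f : koszul M n) x y :
  kfun (kdiff f) x y = kdiff_fun n (kfun f) x y.
Proof. by []. Qed.

Fact kdiff_linear M n : linear (@kdiff M n).
Proof.
move=> c f g; apply: koszul_ext => x y; rewrite kfunP !kdiffE /kdiff_fun.
case: ifP => _; last by rewrite scaler0 addr0.
have D (a b a' b' : M) : c *: (a - b) + (a' - b') = (c *: a + a') - (c *: b + b').
  by rewrite scalerBr opprD addrACA.
case: n f g => [|[|n]] f g.
- by rewrite D !kfunP lactPr ractPl.
- rewrite D /loop; congr (_ - _); rewrite !kfunP lactPr ractPl scalerDr.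
    exact: addrACA.
  exact: addrACA.
by rewrite scaler0 addr0.
Qed.
HB.instance Definition _ M n := GRing.isLinear.Build k _ _ _ (@kdiff M n)
  (@kdiff_linear M n).

Lemma arr_mul_back s t : adj s t -> arr t s * arr s t = emb s s 'X.
Proof.
move=> st; rewrite emb_mul /comp !mulr1 -['X in RHS]expr1 delta_iji.
by congr (emb _ _ 'X^_); move: st; rewrite /adj; lia.
Qed.

Lemma inordS x : (x < N)%N -> (inord x.+1 : obj N) = x.+1 :> nat.
Proof. by move=> xN; rewrite inordK. Qed.
Lemma inordP x : (0 < x)%N -> (inord x.-1 : obj N) = x.-1 :> nat.
Proof. by move=> x0; rewrite inordK //; have := ltn_ord x; lia. Qed.
Lemma adjS x : (x < N)%N -> adj x (inord x.+1 : obj N).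
Proof. by move=> xN; rewrite /adj inordS // eqxx orbT. Qed.
Lemma adjP x : (0 < x)%N -> adj x (inord x.-1 : obj N).
Proof. by move=> x0; rewrite /adj inordP // prednK // eqxx. Qed.
Lemma adj_sym (s t : nat) : adj s t = adj t s.
Proof. by rewrite /adj orbC. Qed.

(** An inner derivation takes the same value on all loops of length 2 at j. *)
Lemma loop_kdiff0 M (f : koszul M 0) (j t : obj N) : adj j t ->
  loop (kfun (kdiff f)) j t =
  lact (emb j j 'X) (kfun f j j) - ract (kfun f j j) (emb j j 'X).
Proof.
move=> jt; rewrite /loop !kdiffE /kdiff_fun /= jt adj_sym jt.
rewrite lactDr lactNr ractDl ractNl -lactM -ractM !arr_mul_back // lract.
by rewrite addrA subrK.
Qed.

Fact kdiff2 M n (f : koszul M n) : kdiff (kdiff f) = 0.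
Proof.
apply: koszul_ext => x y; rewrite kdiffE /kdiff_fun; case: ifP => //.
case: n f => [|n] f //; case/and3P => _ x0 xN.
by rewrite !loop_kdiff0 ?subrr ?adjS ?adjP.
Qed.

Definition koszul_complex M : cochain_complex k :=
  @CochainComplex k (koszul M) (fun n => @kdiff M n) (@kdiff2 M).

Fact koszul_map_subproof M L (f : bimod_hom M L) n (g : koszul M n) :
  is_koszul n (fun x y => f (kfun g x y)).
Proof.
apply: is_koszulE => x y c; last by rewrite kfun_out // bhom0.
by rewrite -bhom_ract -bhom_lact kfun_typed.
Qed.
Definition koszul_map M L (f : bimod_hom M L) n (g : koszul M n) : koszul L n :=
  mk_koszul (koszul_map_subproof f g).

Lemma koszul_map_diff M L (f : bimod_hom M L) n (g : koszul M n) :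
  kdiff (koszul_map f g) = koszul_map f (kdiff g).
Proof.
apply: koszul_ext => x y; rewrite kdiffE -[RHS]/(f (kdiff_fun n (kfun g) x y)).
rewrite /kdiff_fun; case: ifP => _; last by rewrite bhom0.
case: n g => [|[|n]] g; last by rewrite bhom0.
  by rewrite bhomD bhomN bhom_lact bhom_ract.
by rewrite bhomD bhomN !bhomD !bhom_lact !bhom_ract.
Qed.

Lemma koszul_unit_exact M n (u : koszul (coind M) n) :
  koszul_map (cosyzygy_proj M) u = 0 ->
  exists v, koszul_map (coind_unit M) v = u.
Proof.
move=> u0.
have ex (p : obj N * obj N) : exists m, coind_unit M m = kfun u p.1 p.2.
  apply/coker_proj0.
  exact: (congr1 (fun f : koszul (cosyzygy M) n => kfun f p.1 p.2) u0).
have [v vP] := choice ex.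
have vh : is_koszul n (fun x y => v (x, y)).
  apply: is_koszulE => x y c; apply: (@coind_unit_inj _ _ M).
    by rewrite bhom_lact bhom_ract vP kfun_typed.
  by rewrite vP kfun_out // bhom0.
by exists (mk_koszul vh); apply: koszul_ext => x y; exact: (vP (x, y)).
Qed.

Lemma koszul_proj_surj M n (v : koszul (cosyzygy M) n) :
  exists u, koszul_map (cosyzygy_proj M) u = v.
Proof.
have ex (p : obj N * obj N) : exists m, cosyzygy_proj M m = kfun v p.1 p.2.
  exact: coker_proj_surj.
have [u uP] := choice ex.
pose w x y : coind M :=
  if cell n x y then lact (idem k y) (ract (u (x, y)) (idem k x)) else 0.
have wh : is_koszul n w.
  apply: is_koszulE => x y; rewrite /w; last by move=> /negbTE ->.
  by move=> ->; rewrite -lract -lactM -ractM !emb_idemr.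
exists (mk_koszul wh); apply: koszul_ext => x y.
rewrite -[LHS]/(cosyzygy_proj M (w x y)) /w -(kfun_is v).
case: ifP => _; last exact: bhom0.
by rewrite bhom_lact bhom_ract uP.
Qed.

Definition koszul_pt M (f : koszul M 0) : M := \sum_x kfun f x x.

End Koszul.
(** * Acyclicity of the Koszul complex on coinduced bimodules *)

Section Paths.
Variables (k : fieldType) (N : nat).
Notation A := (Calg k N).
Implicit Types (M L : bimodule A) (x y s t i : obj N).

(** For N > 0 this is the existence of a path of length p from i to t. *)
Definition reach i p t : bool := (`|i - t| <= p)%N && ~~ odd (p - `|i - t|).

(** The common value in A of all paths of length p from i to t. *)
Definition path_elt i p t : A := emb i t 'X^((p - `|i - t|)./2).

Lemma path_elt_step i p s t : adj s t -> reach i p s ->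
  arr k s t * path_elt i p s = path_elt i p.+1 t.
Proof.
rewrite /adj /reach => st ip; rewrite emb_mul /comp mul1r -exprD.
by congr (emb _ _ 'X^_); rewrite /delta; lia.
Qed.

Lemma path_elt0 i : path_elt i 0 i = idem k i.
Proof. by rewrite /path_elt sub0n. Qed.

Lemma emb_path_elt i t b : emb i t 'X^b = path_elt i (`|i - t| + b.*2) t.
Proof. by rewrite /path_elt addKn doubleK. Qed.

Lemma reach_emb i t b : reach i (`|i - t| + b.*2) t.
Proof. by rewrite /reach leq_addr addKn odd_double. Qed.

Lemma coind_ext_at M s (f g : coind M) :
  ract f (idem k s) = f -> ract g (idem k s) = g ->
  (forall i p, reach i p s -> cofun f (path_elt i p s) = cofun g (path_elt i p s)) ->
  f = g.
Proof.
move=> fs gs fg; apply: cofun_inj; apply: Calg_linear_eq => [c x y|c x y|i t b].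
- exact: cofunP.
- exact: cofunP.
rewrite -fs -gs !cofun_ract; have [->|st] := eqVneq t s.
  rewrite -!cofun_ract fs gs emb_path_elt; apply: fg; exact: reach_emb.
by rewrite emb_mul0 // !cofun_0r.
Qed.

(** An element of e_t coind(M) e_s can be prescribed at each path ending at s; this
    indexing of the basis of A by lengths is the one which allows recursion. *)
Lemma coind_at_ex M s t (G : obj N -> nat -> M) :
  exists f : coind M,
  [/\ lact (idem k t) (ract f (idem k s)) = f &
      forall i p, reach i p s -> cofun f (path_elt i p s) = lact (idem k t) (G i p)].
Proof.
have [f fl fG] := Calg_linear_ext (fun i s' b =>
  if s' == s then lact (idem k t) (G i (`|i - s| + b.*2)%N) else 0).
exists (mk_coind fl); split=> [|i p ip]; last first.
  rewrite cofunE fG eqxx; congr (lact _ (G i _)).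
  by move: ip; rewrite /reach; lia.
apply: cofun_inj; apply: Calg_linear_eq => [c x y|c x y|i s' b].
- exact: cofunP.
- exact: cofunP.
rewrite cofun_lact cofun_ract !cofunE.
have [->|ss'] := eqVneq s' s.
  by rewrite emb_ideml fG eqxx -lactM emb_idemr.
rewrite emb_mul0 // fG (negbTE ss').
by rewrite linear_fun_0 // lact0r.
Qed.

Section Degree1.
Variables (M : bimodule A) (u : koszul (coind M) 1).
Hypothesis du : kdiff u = 0.

Let psi s t (y : A) : M := cofun (kfun u s t) y.

(** The primitive of u at the paths of length p from i to t: the integral of u
    along one of them, traced backwards from t and coming down from t + 1 whenever
    some path does. *)
Fixpoint primitive i p t : M :=
  if p is q.+1 then
    let up : obj N := inord t.+1 in let down : obj N := inord t.-1 in
    if (t < N)%N && reach i q up then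
      lact (arr k up t) (primitive i q up) - psi up t (path_elt i q up)
    else if (0 < t)%N && reach i q down then
      lact (arr k down t) (primitive i q down) - psi down t (path_elt i q down)
    else 0
  else 0.

Lemma adj_cases s t : adj s t ->
  ((t < N)%N /\ s = inord t.+1) \/ ((0 < t)%N /\ s = inord t.-1).
Proof.
rewrite /adj => st; have := ltn_ord s; have := ltn_ord t => tN sN.
case/orP: st => /eqP st; [left|right].
  have tN' : (t < N)%N by lia.
  by split=> //; apply: val_inj; rewrite /= inordS.
have t0 : (0 < t)%N by lia.
by split=> //; apply: val_inj; rewrite /= inordP // st.
Qed.

Lemma psi_closed t (y : A) : (0 < t < N)%N ->
  let up : obj N := inord t.+1 in let down : obj N := inord t.-1 in
  lact (arr k up t) (psi t up y) + psi up t (arr k t up * y) =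
  lact (arr k down t) (psi t down y) + psi down t (arr k t down * y).
Proof.
move=> tN up down; apply/eqP; rewrite -subr_eq0; apply/eqP.
have c : cell 2 t t by rewrite /= eqxx.
have := congr1 (fun f : koszul (coind M) 2 => cofun (kfun f t t) y) du.
rewrite kdiffE /kdiff_fun c /loop.
by rewrite !(left_linearD _ _ (cofun_left_linear M y))
  !(left_linearN _ (cofun_left_linear M y))
  !(left_linearD _ _ (cofun_left_linear M y)).
Qed.

(** When t can be reached both from above and from below, the two ways differ by
    the relation at the vertex two steps back, whose sides agree by induction. *)
Lemma primitive_step i q s t : adj s t -> reach i q s ->
  primitive i q.+1 t = lact (arr k s t) (primitive i q s) - psi s t (path_elt i q s).
Proof.
elim: q s t => [|q IH] s t st is_ /=.
all: case/adj_cases: (st) => [[tN E]|[t0 E]]; rewrite E in st is_ *.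
all: try by rewrite tN is_.
  case: ifPn => [/andP [tN is']|_]; last by rewrite t0 is_.
  have := inordS tN; have := inordP t0; move: is_ is'.
  by rewrite /reach; lia.
case: ifPn => [/andP [tN is']|_]; last by rewrite t0 is_.
have it : reach i q t.
  have := inordS tN; have := inordP t0; move: is_ is'.
  by rewrite /reach; lia.
have tint : (0 < t < N)%N by rewrite t0 tN.
have tu := adjS tN; have td := adjP t0.
rewrite -!/(primitive i q.+1 _) (IH t _ tu it) (IH t _ td it).
rewrite !lactDr !lactNr -!lactM !arr_mul_back // -!addrA; congr (_ + _).
rewrite -!opprD; congr (- _); have := psi_closed (path_elt i q t) tint.
by rewrite /= !path_elt_step.
Qed.

Lemma koszul_coind_acyclic1 : exists v : koszul (coind M) 0, kdiff v = u.
Proof.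
have [z zP] := choice (fun t => coind_at_ex t t (fun i p => primitive i p t)).
have vP : is_koszul 0 (fun x y => if x == y then z x else 0).
  apply: is_koszulE => x y /=; last by move=> /negbTE ->.
  by move=> /eqP <-; rewrite eqxx; case: (zP x).
exists (mk_koszul vP); apply: koszul_ext => s t; rewrite kdiffE /kdiff_fun /=.
case: ifP => st; last by rewrite kfun_out //= st.
rewrite -[kfun _ s s]/(if s == s then z s else 0).
rewrite -[kfun _ t t]/(if t == t then z t else 0).
rewrite !eqxx; have [zs zsG] := zP s; have [zt ztG] := zP t.
apply: (@coind_ext_at _ s).
- by rewrite ractDl ractNl -ractM arr_idemr -zs -!lract -!ractM emb_idemr.
- by rewrite -(kfun_typed u s t) -lract -ractM emb_idemr.
move=> i p ip; rewrite (left_linearD _ _ (cofun_left_linear M _)).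
rewrite (left_linearN _ (cofun_left_linear M _)) cofun_lact cofun_ract.
rewrite zsG // path_elt_step // ztG; last first.
  by move: ip st; rewrite /reach /adj; lia.
rewrite (primitive_step st ip) -lactM arr_idemr lactDr lactNr -lactM arr_ideml.
rewrite opprD opprK addNKr.
have := congr1 (fun f => cofun f (path_elt i p s)) (kfun_typed u s t).
by move=> <-; rewrite cofun_lact cofun_ract emb_ideml.
Qed.
End Degree1.

Section Degree2.
Variables (M : bimodule A) (u : koszul (coind M) 2).

Let chi j (y : A) : M := cofun (kfun u j j) y.

(** The values on the arrows t -> t + 1, after paths of length p from i to t, of a
    cochain with boundary u which vanishes on all arrows t + 1 -> t. With
    j = t + 1, such an arrow ends the loop j -> t -> j of the relation at j after a
    path of length p - 1 from i to j; this relation determines the value, and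
    where there is none the value is 0. *)
Fixpoint primitive2 i p t : M :=
  if p is q.+1 then
    let j : obj N := inord t.+1 in
    if (t.+1 < N)%N && reach i q j then
      lact (arr k (inord j.+1) j) (primitive2 i q j) - chi j (path_elt i q j)
    else 0
  else 0.

Lemma koszul_coind_acyclic2 : exists v : koszul (coind M) 1, kdiff v = u.
Proof.
have [z zP] := choice (fun t =>
  coind_at_ex t (inord t.+1 : obj N) (fun i p => primitive2 i p t)).
pose w s t := if (t == s.+1 :> nat) then z s else 0.
have wP : is_koszul 1 w.
  apply: is_koszulE => s t; rewrite /w /cell /adj; last first.
    by rewrite negb_or => /andP [_ /negbTE ->].
  move=> _; have [st|_] := boolP (t == s.+1 :> nat); last first.
    by rewrite ract0l lact0r.
  have E : inord s.+1 = t.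
    apply: val_inj; rewrite /= inordS ?(eqP st) //.
    by have := ltn_ord t; rewrite (eqP st).
  by have [zs _] := zP s; rewrite E in zs.
exists (mk_koszul wP); apply: koszul_ext => j j'; rewrite kdiffE /kdiff_fun /=.
case: ifPn => [/and3P [/eqP <- j0 jN]|c]; last by rewrite kfun_out.
set jp : obj N := inord j.+1; set jm : obj N := inord j.-1.
have jpE : jp = j.+1 :> nat by exact: inordS.
have jmE : jm = j.-1 :> nat by exact: inordP.
have jmS : (inord jm.+1 : obj N) = j by apply: val_inj; rewrite /= inordS; lia.
rewrite /loop -[kfun _ j jp]/(w j jp) -[kfun _ jp j]/(w jp j).
rewrite -[kfun _ j jm]/(w j jm) -[kfun _ jm j]/(w jm j) /w jpE jmE eqxx.
rewrite prednK // eqxx !ifN; [|lia|lia].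
rewrite ract0l lact0r addr0 add0r.
have [zj zjG] := zP j; have [zm zmG] := zP jm; rewrite jmS in zm zmG.
apply: (@coind_ext_at _ j).
- by rewrite ractDl ractNl -ractM arr_idemr -zj -!lract -!ractM emb_idemr.
- by rewrite -(kfun_typed u j j) -lract -ractM emb_idemr.
move=> i p ip; rewrite (left_linearD _ _ (cofun_left_linear M _)).
rewrite (left_linearN _ (cofun_left_linear M _)) cofun_lact cofun_ract.
have jjm : adj j jm by exact: adjP.
rewrite zjG // path_elt_step // zmG; last first.
  by move: ip jjm; rewrite /reach /adj; lia.
rewrite /= jmS jmE prednK // jN ip /= -lactM arr_idemr.
rewrite lactDr lactNr -[lact (idem k j) (lact _ _)]lactM arr_ideml.
rewrite opprD opprK addNKr.
have := congr1 (fun f => cofun f (path_elt i p j)) (kfun_typed u j j).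
by move=> <-; rewrite cofun_lact cofun_ract emb_ideml.
Qed.
End Degree2.

Lemma koszul_coind_acyclic M n (u : koszul (coind M) n.+1) :
  kdiff u = 0 -> exists v : koszul (coind M) n, kdiff v = u.
Proof.
case: n u => [|[|n]] u du.
- exact: koszul_coind_acyclic1.
- exact: koszul_coind_acyclic2.
by exists 0; apply: koszul_ext => x y; rewrite [RHS]kfun_out.
Qed.

Section Degree0.
Hypothesis N_gt0 : (0 < N)%N.

Lemma reach_step i p t : reach i p.+1 t -> exists2 s : obj N, adj s t & reach i p s.
Proof.
rewrite /reach => ip.
have [it|it] := leqP t i; have [tN|tN] := ltnP t N.
- exists (inord t.+1); first by rewrite adj_sym adjS.
  by rewrite inordS //; lia.
- exists (inord t.-1); first by rewrite adj_sym adjP //; lia.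
  by rewrite inordP; have := ltn_ord i; lia.
- exists (inord t.-1); first by rewrite adj_sym adjP //; lia.
  by rewrite inordP; lia.
- exists (inord t.-1); first by rewrite adj_sym adjP //; lia.
  by rewrite inordP; lia.
Qed.

(** Commuting with the arrows is commuting with A, as the arrows generate A when
    N > 0. *)
Lemma koszul0_cocycle M (f : koszul M 0) : kdiff f = 0 ->
  forall x y a, ract (kfun f y y) (emb x y a) = lact (emb x y a) (kfun f x x).
Proof.
move=> df.
have E s t : adj s t ->
    ract (kfun f t t) (arr k s t) = lact (arr k s t) (kfun f s s).
  move=> st; apply/eqP; rewrite eq_sym -subr_eq0.
  have := congr1 (fun g : koszul M 1 => kfun g s t) df.
  by rewrite kdiffE /kdiff_fun /= st => ->.
have T' s : lact (idem k s) (kfun f s s) = kfun f s s.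
  by rewrite -(kfun_typed f s s) -lactM emb_idemr.
have T s : ract (kfun f s s) (idem k s) = kfun f s s.
  by rewrite -(kfun_typed f s s) -lract -ractM emb_idemr.
have P i p t : reach i p t ->
    ract (kfun f t t) (path_elt i p t) = lact (path_elt i p t) (kfun f i i).
  elim: p t => [|p IH] t ip.
    have <- : i = t by apply: val_inj => /=; move: ip; rewrite /reach; lia.
    by rewrite path_elt0 T T'.
  have [s st is_] := reach_step ip.
  by rewrite -(path_elt_step st is_) ractM E // -lract IH // lactM.
move=> x y a.
have l1 : linear (fun a => ract (kfun f y y) (emb x y a)).
  by move=> c p q; rewrite emb_linear ractPr.
have l2 : linear (fun a => lact (emb x y a) (kfun f x x)).
  by move=> c p q; rewrite emb_linear lactPl.
rewrite (linear_polyE l1) (linear_polyE l2); apply: eq_bigr => b _.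
by congr (_ *: _); rewrite emb_path_elt P // reach_emb.
Qed.

Definition koszul_theory : cohomology_theory A.
Proof.
refine (@CohomologyTheory k A (fun M => koszul_complex M)
  (@koszul_map k N) _ _ _ (@koszul_unit_exact k N) _ (@koszul_proj_surj k N)
  koszul_coind_acyclic (@koszul_pt k N) _ _ _ _ _).
- move=> M L f n c u v; apply: koszul_ext => x s; rewrite kfunP.
  by rewrite -[LHS]/(f (kfun (c *: u + v) x s)) kfunP bhomP.
- exact: koszul_map_diff.
- move=> M L f n f_inj u v uv; apply: koszul_ext => x s; apply: f_inj.
  exact: (congr1 (fun g : koszul L n => kfun g x s) uv).
- move=> M n u; apply: koszul_ext => x s.
  by apply/(coker_proj0 (coind_unit M)); exists (kfun u x s).
- move=> M c u v; rewrite /koszul_pt scaler_sumr -big_split.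
  by apply: eq_bigr => x _; rewrite kfunP.
- move=> M L f u; rewrite /koszul_pt.
  by rewrite [RHS](big_morph _ (bhomD f) (bhom0 f)).
- move=> M u du; apply: (central_sum (m := fun x => kfun u x x)) => [x|].
    exact: kfun_typed.
  exact: koszul0_cocycle.
- move=> M m mc.
  have uP : is_koszul 0 (fun x y : obj N => if x == y then lact (idem k x) m else 0).
    apply: is_koszulE => x y /=; last by move=> /negbTE ->.
    by move=> /eqP <-; rewrite eqxx; exact: central_typed.
  exists (mk_koszul uP).
    apply: koszul_ext => x y; rewrite kdiffE /kdiff_fun /=; case: ifP => // _.
    rewrite -[kfun _ x x]/(if x == x then lact (idem k x) m else 0).
    rewrite -[kfun _ y y]/(if y == y then lact (idem k y) m else 0) !eqxx.
    by rewrite central_emb ?subrr.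
  rewrite -[RHS](central_sum_idem m); apply: eq_bigr => x _.
  by rewrite -[LHS]/(if x == x then lact (idem k x) m else 0) eqxx.
- move=> M u du u0; apply: koszul_ext => x y.
  have [<-|xy] := eqVneq x y; last by rewrite kfun_out.
  exact: (typed_sum0 (m := fun x => kfun u x x) (fun x => kfun_typed u x x) u0).
Defined.
End Degree0.

End Paths.
(** * Cohomology of the Koszul complex of the braiding bimodule *)

Section DirectSum.
Variables (k : fieldType) (m : nat).

(** Identifies the polynomials divisible by 'X^m with the direct sum. *)
Definition same_coefs (p : {poly k}) (w : ksum_ge k m) : Prop :=
  forall l : {l : nat | (m <= l)%N}, (w : {malg k[_]})@_l = p`_(val l).

Lemma same_coefs_linear : linear_rel same_coefs.
Proof.
move=> c p w p' w' pw pw' l; rewrite coefD coefZ -pw -pw'.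
by rewrite [LHS]mcoeffD mcoeffZ.
Qed.

Lemma same_coefs_ex p : exists w, same_coefs p w.
Proof.
pose G (b : nat) : {malg k[{l : nat | (m <= l)%N}]} :=
  if insub b is Some l then << l >> else 0.
exists (poly_ext G p) => l; rewrite /poly_ext raddf_sum /=.
under eq_bigr => b _ do rewrite mcoeffZ.
have GE (b : nat) : (G b)@_l = (b == val l)%:R.
  rewrite /G; case: insubP => [l' _ <-|/negbTE bm]; first by rewrite mcoeffU val_eqE.
  by rewrite mcoeff0; case: eqP => // E; rewrite E (valP l) in bm.
have [lp|lp] := ltnP (val l) (size p); last first.
  rewrite nth_default // big1 // => b _; rewrite GE ltn_eqF ?mulr0 //.
  exact: leq_trans (ltn_ord b) lp.
rewrite (bigD1 (Ordinal lp)) //= GE eqxx mulr1 big1 ?addr0 // => b bl.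
by rewrite GE (_ : (b == val l :> nat) = (b == Ordinal lp)) // (negbTE bl) mulr0.
Qed.

Lemma same_coefs_surj w :
  exists2 p, same_coefs p w & forall l, (l < m)%N -> p`_l = 0.
Proof.
exists (\sum_(l <- msupp (w : {malg k[_]})) (w : {malg k[_]})@_l *: 'X^(val l)).
  move=> l; rewrite [in LHS](monalgE w) raddf_sum coef_sum; apply: eq_bigr => l' _.
  by rewrite /= mcoeffU coefZ coefXn eq_sym val_eqE mulr_natr.
move=> l lm; rewrite coef_sum big1 // => l' _.
rewrite coefZ coefXn ltn_eqF ?mulr0 //.
exact: leq_trans lm (valP l').
Qed.

Lemma same_coefs0 p w : same_coefs p w -> (forall l, (l < m)%N -> p`_l = 0) ->
  p = 0 <-> w = 0.
Proof.
move=> pw p0; split=> [p_0|w0].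
  by apply/malgP => l; rewrite (pw l) p_0 coef0 mcoeff0.
apply/polyP => l; rewrite coef0; have [/p0 //|ml] := ltnP l m.
by have := pw (exist _ l ml); rewrite w0 mcoeff0 => /= <-.
Qed.
End DirectSum.

Section Braiding.
Variables (k : fieldType) (N : nat) (i : obj N).
Hypothesis N_ge2 : (2 <= N)%N.
Hypothesis i_int : (1 <= i <= N - 1)%N.
Notation A := (Calg k N).
Notation B := (B_bimod k i).
Implicit Types (x y s t j : obj N).

Definition Bval (m : B) : A := submod_val m.

Lemma BvalP c (m m' : B) : Bval (c *: m + m') = c *: Bval m + Bval m'.
Proof. exact: submod_valP. Qed.
Lemma Bval_lact (a : A) (m : B) : Bval (lact a m) = a * Bval m.
Proof. by []. Qed.
Lemma Bval_ract (m : B) (a : A) : Bval (ract m a) = Bval m * a.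
Proof. by []. Qed.
Lemma Bval_inj : injective Bval.
Proof. exact: val_inj. Qed.
Lemma Bval0 : Bval 0 = 0.
Proof. by []. Qed.
Lemma BvalB (m m' : B) : Bval (m - m') = Bval m - Bval m'.
Proof. by rewrite addrC -scaleN1r BvalP scaleN1r addrC. Qed.
Lemma BvalD (m m' : B) : Bval (m + m') = Bval m + Bval m'.
Proof. by rewrite -[m in LHS]scale1r BvalP scale1r. Qed.

Lemma Bval_ecoef (m : B) : ecoef i (Bval m) = 0.
Proof. exact: (submodP (m : submod (bimod_ker_space (pi_hom k i)))). Qed.

Lemma Bval_ex (a : A) : ecoef i a = 0 -> exists m : B, Bval m = a.
Proof.
by move=> a0; exists (to_submod (S := bimod_ker_space (pi_hom k i)) a0).
Qed.

(** The cochains of B as families of polynomials, one for each cell. *)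
Definition coord n (f : koszul B n) x y : {poly k} := Bval (kfun f x y) (x, y).

Lemma kfun_coord n (f : koszul B n) x y :
  Bval (kfun f x y) = emb x y (coord f x y).
Proof.
rewrite -[in LHS](kfun_typed f x y) Bval_lact Bval_ract mulrA idem_mul_sum.
rewrite mulr_suml (bigD1 x) //= [X in _ + X]big1 => [|z zx].
  by rewrite addr0 emb_idemr.
by rewrite emb_mul0 // eq_sym.
Qed.

Lemma coordP n c (f g : koszul B n) x y :
  coord (c *: f + g) x y = c *: coord f x y + coord g x y.
Proof. by rewrite /coord kfunP BvalP !ffunE. Qed.

Lemma coord_out n (f : koszul B n) x y : ~~ cell n x y -> coord f x y = 0.
Proof. by move=> c; rewrite /coord kfun_out // Bval0 ffunE. Qed.

Lemma coord_inj n (f g : koszul B n) :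
  (forall x y, cell n x y -> coord f x y = coord g x y) -> f = g.
Proof.
move=> fg; apply: koszul_ext => x y; apply: Bval_inj; rewrite !kfun_coord.
by have [/fg ->|c] := boolP (cell n x y); rewrite // !coord_out.
Qed.

Lemma coord_i n (f : koszul B n) : (coord f i i)`_0 = 0.
Proof. exact: (Bval_ecoef (kfun f i i)). Qed.

Lemma coord_ex n (F : obj N -> obj N -> {poly k}) : (F i i)`_0 = 0 ->
  exists f : koszul B n, forall x y, cell n x y -> coord f x y = F x y.
Proof.
move=> F0.
have ex (p : obj N * obj N) : exists m : B, Bval m =
    if cell n p.1 p.2 then emb p.1 p.2 (F p.1 p.2) else 0.
  case: p => x y /=; apply: Bval_ex.
  case: ifP => _; rewrite /ecoef ffunE ?coef0 //.
  by rewrite xpair_eqE; case: andP => [[/eqP <- /eqP <-]|]; rewrite ?coef0.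
have [u uP] := choice ex.
have uk : is_koszul n (fun x y => u (x, y)).
  apply: is_koszulE => x y c; apply: Bval_inj; last by rewrite uP (negbTE c).
  by rewrite Bval_lact Bval_ract uP /= c emb_idemr emb_ideml.
exists (mk_koszul uk) => x y c.
by rewrite /coord -[kfun _ x y]/(u (x, y)) uP /= c ffunE eqxx.
Qed.

Lemma coord_diff0 (f : koszul B 0) x y : adj x y ->
  coord (kdiff f) x y = coord f x x - coord f y y.
Proof.
move=> xy; rewrite /coord kdiffE /kdiff_fun /cell xy BvalB Bval_lact Bval_ract.
rewrite !kfun_coord !emb_mul /comp delta_iij delta_ijj expr0 !mul1r mulr1.
by rewrite !ffunE !eqxx.
Qed.

Lemma coord_loop (f : koszul B 1) j t : adj j t ->
  Bval (loop (kfun f) j t) = emb j j ('X * (coord f j t + coord f t j)).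
Proof.
move=> jt; rewrite /loop BvalD Bval_lact Bval_ract !kfun_coord !emb_mul /comp.
have -> : delta j t j = 1%N by rewrite delta_iji; move: jt; rewrite /adj; lia.
rewrite expr1 mul1r mulr1 mulrDr; apply/ffunP => p; rewrite !ffunE.
by case: ifP => // _; rewrite addr0.
Qed.

Lemma coord_diff1 (f : koszul B 1) j : (0 < j < N)%N ->
  let up : obj N := inord j.+1 in let down : obj N := inord j.-1 in
  coord (kdiff f) j j =
  'X * (coord f j up + coord f up j - (coord f j down + coord f down j)).
Proof.
move=> jN up down; have c : cell 2 j j by rewrite /= eqxx.
case/andP: jN => j0 jN.
rewrite /coord kdiffE /kdiff_fun c BvalB !coord_loop ?adjS ?adjP //.
by rewrite !ffunE eqxx mulrBr.
Qed.

Lemma nat_chain_eq (T : Type) (g : nat -> T) n :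
  (forall l, (0 < l < n)%N -> g l = g l.-1) -> forall l, (l < n)%N -> g l = g 0%N.
Proof.
move=> h; elim=> [//|l IH] ln; rewrite h /=; last by rewrite ln.
exact: (IH (ltnW ln)).
Qed.

(** The components of a cocycle are all equal, and the one at i is divisible by
    'X. *)
Lemma koszul_B0 : lin_isomorphic (cohomology (koszul_complex B) 0) (ksum_ge k 1).
Proof.
apply: (@cohomology_iso_mod k (koszul_complex B) 0 (ksum_ge k 1)
  (fun (z : koszul B 0) w =>
  exists2 p, forall x, coord z x x = p & same_coefs p w)).
- move=> c z w z' w' [p zp pw] [p' zp' pw']; exists (c *: p + p').
    by move=> x; rewrite coordP zp zp'.
  exact: same_coefs_linear.
- move=> z dz; have [w pw] := same_coefs_ex 1 (coord z ord0 ord0).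
  exists w, (coord z ord0 ord0) => // x.
  pose g (j : nat) := let x := inord j : obj N in coord z x x.
  have gS (j : nat) : (0 < j < N.+1)%N -> g j = g j.-1.
    move=> jN; apply/eqP; rewrite -subr_eq0 -coord_diff0.
      by rewrite [kdiff z]dz /coord Bval0 ffunE.
    by rewrite /adj !inordK; lia.
  have := nat_chain_eq gS (ltn_ord x); rewrite /g inord_val => ->.
  by rewrite (_ : inord 0 = ord0 :> obj N) //; apply: val_inj; rewrite /= inordK.
- move=> w; have [p pw p0] := same_coefs_surj w.
  have [z zp] := @coord_ex 0 (fun _ _ => p) (p0 0%N isT).
  exists z; last by exists p => // x; rewrite zp /=.
  apply: coord_inj => x y xy; rewrite coord_diff0 // !zp /= ?eqxx // subrr.
  by rewrite /coord Bval0 ffunE.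
- move=> z w dz [p zp pw]; rewrite -(same_coefs0 pw); last first.
    by case=> // _; rewrite -(zp i) coord_i.
  split=> [z0|p0].
    by rewrite -(zp ord0) (z0 : z = 0) /coord Bval0 ffunE.
  apply: coord_inj => x y /eqP <-.
  by rewrite zp p0 /coord Bval0 ffunE.
Qed.

(** The class of a cocycle f is the sum of f over the two arrows between s and
    s + 1: the relations make it independent of s. *)
Lemma koszul_B1 : lin_isomorphic (cohomology (koszul_complex B) 1) (ksum_ge k 0).
Proof.
apply: (@cohomology_iso_mod k (koszul_complex B) 1 (ksum_ge k 0)
  (fun (f : koszul B 1) w =>
  exists2 p, forall s t, adj s t -> coord f s t + coord f t s = p
           & same_coefs p w)).
- move=> c f w f' w' [p fp pw] [p' fp' pw']; exists (c *: p + p').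
    move=> s t st; rewrite !coordP -(fp s t st) -(fp' s t st) scalerDr.
    exact: addrACA.
  exact: same_coefs_linear.
- move=> f df.
  pose g (j : nat) := let s := inord j : obj N in let t := inord j.+1 : obj N in
    coord f s t + coord f t s.
  have [w pw] := same_coefs_ex 0 (g 0%N); exists w, (g 0%N) => //.
  have gS (j : nat) : (0 < j < N)%N -> g j = g j.-1.
    move=> jN; pose s : obj N := inord j.
    have sj : s = j :> nat by rewrite inordK //; lia.
    have sN : (0 < s < N)%N by rewrite sj.
    have := coord_diff1 f sN; rewrite [kdiff f]df /coord Bval0 ffunE => /esym/eqP.
    rewrite mulf_eq0 polyX_eq0 /= subr_eq0 => /eqP E.
    by rewrite /g prednK 1?[RHS]addrC -?sj ?inord_val //; case/andP: sN.
  have gE := nat_chain_eq gS.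
  have up (s t : obj N) : t = s.+1 :> nat -> coord f s t + coord f t s = g 0%N.
    move=> st; have sN : (s < N)%N by have := ltn_ord t; rewrite st.
    by rewrite -(gE _ sN) /g inord_val -st inord_val.
  by move=> s t /orP [/eqP st|/eqP st]; [rewrite addrC|]; exact: up.
- move=> w; have [p pw _] := same_coefs_surj w.
  pose F s t : {poly k} := if (t == s.+1 :> nat) then p else 0.
  have [|f fF] := @coord_ex 1 F; first by rewrite /F ltn_eqF ?coef0.
  have fp s t : adj s t -> coord f s t + coord f t s = p.
    move=> st; rewrite !fF //; last by rewrite /cell adj_sym.
    rewrite /F; move: st => /orP [] /eqP ->;
      rewrite eqxx ltn_eqF ?addr0 ?add0r //; lia.
  exists f; last by exists p.
  apply: coord_inj => j y /and3P [/eqP <- j0 jN]; rewrite coord_diff1 ?j0 //=.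
  rewrite !fp ?adjS ?adjP // subrr mulr0.
  by rewrite /coord Bval0 ffunE.
- move=> f w df [p fp pw]; rewrite -(same_coefs0 pw) //; split=> [[z zf]|p0].
    have st : adj (inord 0 : obj N) (inord 1 : obj N).
      by rewrite /adj !inordK //; lia.
    rewrite -(fp _ _ st) -zf !coord_diff0 //; last by rewrite adj_sym.
    by rewrite addrA subrK subrr.
  (* Summing from i makes the component at i zero, as its constant term must be. *)
  pose a l := coord f (inord l) (inord l.+1).
  pose S (j : nat) := \sum_(l < j) a l.
  have [|z zP] := @coord_ex 0 (fun x _ => S i - S x); first by rewrite subrr coef0.
  exists z; apply: coord_inj => s t st; rewrite coord_diff0 // !zP /= ?eqxx //.
  rewrite opprB addrC addrA subrK.
  have up (s' t' : obj N) : t' = s'.+1 :> nat -> S t' - S s' = coord f s' t'.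
    move=> E; rewrite E /S big_ord_recr /= addrAC subrr add0r /a inord_val -E.
    by rewrite inord_val.
  case/orP: st => /eqP st; last exact: up.
  have := fp s t; rewrite /adj st eqxx p0 => /(_ isT)/eqP.
  by rewrite addr_eq0 -(up t s st) opprB => /eqP ->; rewrite st.
Qed.

(** The interior vertices other than i, listed in increasing order. *)
Definition other_vertex (h : 'I_(N - 2)) : obj N := inord (bump i.-1 h).+1.

Lemma other_vertexE h : other_vertex h = (bump i.-1 h).+1 :> nat.
Proof. by rewrite inordK //; have := ltn_ord h; rewrite /bump; lia. Qed.

Lemma other_vertex_inj : injective other_vertex.
Proof.
move=> h h' /(congr1 (@nat_of_ord _)); rewrite !other_vertexE => -[] E.
by apply: val_inj; exact: (can_inj (bumpK _) E).
Qed.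

Lemma other_vertex_neq h : other_vertex h != i.
Proof.
by rewrite -val_eqE /= other_vertexE; rewrite /bump; lia.
Qed.

Lemma other_vertex_int h : (0 < other_vertex h < N)%N.
Proof. by rewrite other_vertexE; have := ltn_ord h; rewrite /bump; lia. Qed.

Lemma other_vertex_surj j : (0 < j < N)%N -> j != i -> exists h, other_vertex h = j.
Proof.
rewrite -val_eqE /= => jN ji.
have hN : (unbump i.-1 j.-1 < N - 2)%N by rewrite /unbump; lia.
exists (Ordinal hN); apply: val_inj.
by rewrite /= other_vertexE /= unbumpK ?inE; lia.
Qed.

(** The coboundaries are the families divisible by 'X, and the component at i is
    so by definition of B. *)
Lemma koszul_B2 :
  lin_isomorphic (cohomology (koszul_complex B) 2) 'rV[k]_(N - 2).
Proof.
pose ev (f : koszul B 2) : 'rV[k]_(N - 2) :=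
  \row_h (coord f (other_vertex h) (other_vertex h))`_0.
apply: (@cohomology_iso_mod k (koszul_complex B) 2 'rV_(N - 2)
  (fun (f : koszul B 2) w => ev f = w)).
- move=> c f w f' w' <- <-; apply/rowP => h.
  by rewrite !mxE coordP coefD coefZ.
- by move=> f _; exists (ev f).
- move=> w.
  pose F j (_ : obj N) := (\sum_(h | other_vertex h == j) w 0 h)%:P.
  have [|f fF] := @coord_ex 2 F.
    by rewrite coefC /= big1 // => h; rewrite (negbTE (other_vertex_neq h)).
  exists f; first by apply: coord_inj.
  apply/rowP => h; rewrite mxE fF; last by rewrite /cell eqxx other_vertex_int.
  rewrite coefC /= (bigD1 h) //= big1 ?addr0 // => h' /andP [/eqP E].
  by rewrite (other_vertex_inj E) eqxx.
- move=> f w df <-; split=> [[g gf]|f0].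
    apply/rowP => h; rewrite !mxE -gf coord_diff1 ?other_vertex_int //.
    by rewrite coefXM.
  have fj0 j : (0 < j < N)%N -> (coord f j j)`_0 = 0.
    move=> jN; have [->|/(other_vertex_surj jN) [h <-]] := eqVneq j i.
      exact: coord_i.
    by have := congr1 (fun v : 'rV_(N - 2) => v 0 h) f0; rewrite !mxE.
  (* The sums of g over the arrows between j and j + 1 have to increase by q j. *)
  pose q (j : nat) : {poly k} := drop_poly 1 (coord f (inord j) (inord j)).
  pose S (j : nat) := \sum_(l < j) q l.+1.
  pose F s t := if (t == s.+1 :> nat) then S s else 0.
  have [|g gF] := @coord_ex 1 F; first by rewrite /F ltn_eqF ?coef0.
  have gS s t : adj s t -> coord g s t + coord g t s = S (minn s t).
    move=> st; rewrite !gF //; last by rewrite /cell adj_sym.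
    rewrite /F; move: st => /orP [] /eqP ->;
      rewrite eqxx ltn_eqF ?addr0 ?add0r //; try lia.
      by congr S; lia.
    by congr S; lia.
  exists g; apply: coord_inj => j y /and3P [/eqP <- j0 jN].
  rewrite coord_diff1 ?j0 //= !gS ?adjS ?adjP //.
  have -> : minn j (inord j.+1 : obj N) = j.-1.+1 by rewrite inordS //; lia.
  have -> : minn j (inord j.-1 : obj N) = j.-1 by rewrite inordP //; lia.
  rewrite /S big_ord_recr /= addrAC subrr add0r prednK // /q inord_val.
  apply/polyP => -[|l]; rewrite coefXM /=; first by rewrite fj0 // j0.
  by rewrite coef_drop_poly addn1.
Qed.

Lemma koszul_B_ge3 n :
  lin_isomorphic (cohomology (koszul_complex B) n.+3) 'rV[k]_0.
Proof.
have z m (f : koszul B m.+3) : f = 0.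
  by apply: koszul_ext => x y; rewrite !kfun_out.
apply: (@cohomology_iso_mod k (koszul_complex B) n.+3 'rV_0
  (fun _ _ => True)) => //.
- by exists 0.
- by exists 0 => //; exact: z.
- move=> u w _ _; split=> [_|_]; first by apply/rowP => -[].
  by exists 0; rewrite [u]z; exact: z.
Qed.

Lemma koszul_B n :
  lin_isomorphic (cohomology (koszul_complex B) n) (HH_value k N n).
Proof.
case: n => [|[|[|n]]].
- exact: koszul_B0.
- exact: koszul_B1.
- exact: koszul_B2.
- exact: koszul_B_ge3.
Qed.

End Braiding.

Theorem theorem7p4 (k : fieldType) (N : nat) (i : 'I_N.+1)
    (P : projective_resolution (diagonal (Calg k N))) (n : nat) :
  (2 <= N)%N -> (1 <= i <= N - 1)%N ->
  lin_isomorphic (HNat (B_bimod k i) n) (HH P (B_bimod k i) n) /\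
  lin_isomorphic (HH P (B_bimod k i) n) (HH_value k N n).
Proof.
move=> N2 iN.
pose T := ext_theory (@Calg_lifts_linear_maps k N) P.
split; first exact: (theory_unique (@prenat_theory k N) T).
exact: (lin_iso_trans (theory_unique T (koszul_theory k (ltnW N2)) n _)
  (koszul_B k N2 iN n)).
Qed.
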